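(* Suppose that $\sum_{m} r(m)^{-2}=\infty$. Then, as $m\to\infty$, $$\frac{\log N_m-\bigl(y_m+\log r(m)\bigr)}{\hat\sigma_m}\longrightarrow N(0,1)\quad\text{in distribution},$$ where $$y_m:=\sum_{k=1}^m\frac{\delta_k}{r(k)},\qquad \hat\sigma_m^2:=\sum_{k=1}^m\frac1{r(k)^2}\quad(\hat\sigma_m>0).$$
   Context: Hiring process. $(r(m))_{m\ge0}$ is a given sequence of integers with $r(0)=1$ and $r(m)\le r(m+1)\le r(m)+1$ for all $m\ge0$ (hence $1\le r(m)\le m+1$). The values $X_1,X_2,\dots$ of the candidates are i.i.d. $\mathrm{Exp}(1)$ random variables (a.s. distinct). Candidates are examined one by one. If $m\ge0$ candidates have been accepted so far, the next candidate is accepted if and only if her value exceeds the threshold $Y_m$, where $Y_m$ is the $r(m)$-th largest of the $m$ values already accepted if $r(m)\le m$, and $Y_m:=0$ if $r(m)=m+1$ (so $Y_0=0$). $N_m$ is the index of the $m$-th accepted candidate. $\delta_k:=1$ if $r(k)=r(k-1)$ and $\delta_k:=0$ if $r(k)=r(k-1)+1$, $k\ge1$. *)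

(* Defs.v *)
From HB Require Import structures.
From mathcomp Require Import all_boot all_order all_algebra finmap.
From mathcomp Require Import all_classical all_reals all_analysis.

Set Implicit Arguments.
Unset Strict Implicit.
Unset Printing Implicit Defensive.

Import Order.TTheory GRing.Theory Num.Theory.
Import numFieldNormedType.Exports.

Local Open Scope classical_set_scope.
Local Open Scope ring_scope.

Definition mutually_independent (d : measure_display) (T : measurableType d)
    (R : realType) (P : probability T R) (X : nat -> {RV P >-> R}) : Prop :=
  forall (J : {fset nat}) (A : nat -> set R),
    (forall j, measurable (A j)) ->
    P (\bigcap_(j in [set` J]) (X j @^-1` A j)) =
    (\prod_(j <- J) P (X j @^-1` A j))%E.

Definition has_law (d : measure_display) (T : measurableType d)
    (R : realType) (P : probability T R) (X : {RV P >-> R})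
    (mu : set R -> \bar R) : Prop :=
  forall A : set R, measurable A -> distribution P X A = mu A.

(* Pointwise convergence of the distribution functions at the continuity
   points of the distribution function of the limit law [mu], that is, at the
   points [t] that are not atoms of [mu]. *)
Definition cvg_in_distribution (d : measure_display) (T : measurableType d)
    (R : realType) (P : probability T R) (W : nat -> T -> R)
    (mu : probability (measurableTypeR R) R) : Prop :=
  (forall n, measurable_fun [set: T] (W n)) /\
  (forall t : R, mu [set t] = 0%E ->
     P [set w | W n w <= t] @[n --> \oo] --> mu [set` `]-oo, t]]).

(* [s] lists the values accepted so far; entry 0 of the decreasing
   rearrangement is the largest, so entry [(r m).-1] is the [r m]-th largest. *)
Definition threshold (R : realType) (r : nat -> nat) (s : seq R) : R :=
  let m := size s in
  if (r m <= m)%N then nth 0 (sort >=%R s) (r m).-1 else 0.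

(* Candidates are numbered from 1 and candidate [k.+1] has value [x k];
   [accepted r x n] lists the values accepted among the first [n] candidates. *)
Fixpoint accepted (R : realType) (r : nat -> nat) (x : nat -> R) (n : nat)
    : seq R :=
  if n is k.+1 then
    let s := accepted r x k in
    if threshold r s < x k then rcons s (x k) else s
  else [::].

(* The number [n] of the candidate whose acceptance brings the number of
   accepted candidates to [m]. For [m >= 1] there is at most one such [n];
   the default value 0 is used when there is none (for i.i.d. exponential
   values, an event of probability 0), and for [m = 0]. *)
Definition accepted_index (R : realType) (r : nat -> nat) (x : nat -> R)
    (m : nat) : nat :=
  xget 0%N [set n | (size (accepted r x n.-1) < size (accepted r x n))%N /\
                    size (accepted r x n) = m].

(* Only used for [k >= 1]. *)
Definition delta (r : nat -> nat) (k : nat) : nat := (r k == r k.-1).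

Definition ysum (R : realType) (r : nat -> nat) (m : nat) : R :=
  \sum_(1 <= k < m.+1) (delta r k)%:R / (r k)%:R.

Definition sigmahat (R : realType) (r : nat -> nat) (m : nat) : R :=
  Num.sqrt (\sum_(1 <= k < m.+1) ((r k)%:R ^+ 2)^-1).

(* Main.v *)
Require Import Defs.
From HB Require Import structures.
From mathcomp Require Import all_boot all_order all_algebra finmap.
From mathcomp Require Import all_classical all_reals all_analysis.
From mathcomp Require Import measurable_realfun.
From mathcomp Require Import ring lra.

Set Implicit Arguments.
Unset Strict Implicit.
Unset Printing Implicit Defensive.

Import Order.TTheory GRing.Theory Num.Theory.
Import numFieldNormedType.Exports.

Local Open Scope classical_set_scope.
Local Open Scope ring_scope.

(* A rejected value never matters again, as [r] grows by at most one: with [m]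
   candidates accepted, the next one is accepted iff its rank among all values
   seen so far is at most [r m].  The rank of candidate [n + 1] is uniform on
   [1 .. n + 1] and independent of the past, so the number [M_n] of accepted
   candidates is a Markov chain that jumps from [m] with probability
   [r m / (n + 1)], whatever the atomless law of the values.  With [H_n] the harmonic
   numbers and [S m], [V m] the sums of [1 / r k] and [1 / r k ^ 2] over
   [k < m], the process [H_n - S (M_n)] is a martingale, and the conditional
   variances between the acceptances [k] and [k + 1] add up to [1 / r k ^ 2] up
   to a total error of at most [sum 1 / n ^ 2].  Lindeberg's method applies to
   this martingale with the test functions [Phi ((c - z) / sqrt tau)]: they
   solve the heat equation, so the Gaussian side of the comparison is explicit.
   This gives [P (M_n >= m)], that is [P (N_m <= n)].  Finally
   [S m = y_m + ln (r m) + O(1)] and [H_n = ln n + O(1)]. *)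

(** * The normal distribution function *)

(** The conditional variance accumulated up to a given time is random; clocked by the state [k] it
    is deterministic up to a summable error. So the comparison function carries the remaining
    variance [V m - V k], read off the state, and no convergence of a random variance has to be
    shown. This remaining variance shrinks near [k = m], where the Taylor remainders would explode;
    adding [s ^+ 2] keeps the scale at least [s], and the remainders then total a constant times
    [2 / s^2 + V m / s^3]. With [s = eps * sigmahat m], [eps] fixed, this tends to 0, since [V m] is
    within 1 of [sigmahat m ^+ 2]. The smoothing displaces the threshold by a multiple of
    [eps * sigmahat m], which is paid for by comparing at a point [x] slightly above or below [t];
    continuity of [Phi] closes the gap. Reaching [m] is handled by freezing the comparison function
    there, so that finite sums against [chain_law] replace filtrations and stopping times. *)

Definition normal_cdf (R : realType) (x : R) : R :=
  fine (normal_prob 0 1 `]-oo, x]).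

Section normal_cdf.
Variable R : realType.
Implicit Types x y e p : R.
Local Notation Phi := (@normal_cdf R).
Local Notation phi := (@normal_pdf R 0 1).

Lemma normal_cdfE x : normal_prob 0 1 `]-oo, x] = (Phi x)%:E.
Proof. by rewrite /normal_cdf fineK// fin_num_measure. Qed.

Lemma normal_pdf01E x : phi x = normal_peak 1 * expR (- (x ^+ 2 / 2)).
Proof.
by rewrite /normal_pdf oner_eq0 /normal_fun subr0 expr1n mulNr.
Qed.

Lemma is_derive_normal_cdf x : is_derive x 1 Phi (phi x).
Proof.
have [||||d e] := @continuous_FTC1 R phi -oo%O x (x + 1).
- by rewrite ltrDl.
- exact: integrableS (integrable_normal_pdf 0 1).
- by rewrite ltNyr.
- by apply: continuous_normal_pdf; rewrite oner_eq0.
- by apply: DeriveDef; [exact: d|rewrite -derive1E; exact: e].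
Qed.

Lemma is_derive_normal_pdf x : is_derive x 1 phi (- x * phi x).
Proof.
have -> : (phi : R -> R) = (fun x => normal_peak 1 * expR (- (x ^+ 2 / 2))).
  by apply/funext => y; rewrite normal_pdf01E.
apply: is_derive_eq; rewrite /GRing.scale /=; lra.
Qed.

(** The fourth power dominates all moments of order at most 4, so this one constant serves every
    Taylor estimate below. The reason: exp(x^2/2) is the square of exp(x^2/4) >= 1 + x^2/4, and 16
    (1 + x^2/4)^2 >= 1 + x^4. *)
Lemma normal_pdf_bound x : (1 + x ^+ 4) * phi x <= 16 * normal_peak 1.
Proof.
have e1 : 1 + x ^+ 2 / 4 <= expR (x ^+ 2 / 4) by exact: expR_ge1Dx.
have e2 : expR (x ^+ 2 / 2) = expR (x ^+ 2 / 4) ^+ 2.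
  by rewrite [RHS]expr2 -expRD; congr expR; lra.
rewrite normal_pdf01E expRN e2.
have c0 : 0 < normal_peak 1 :> R by rewrite normal_peak_gt0// oner_eq0.
have x2 : 0 <= x ^+ 2 by exact: sqr_ge0.
rewrite mulrCA [leRHS]mulrC ler_pM2l//.
rewrite ler_pdivrMr; last by rewrite exprn_gt0// expR_gt0.
move: e1; set E := expR _; rewrite (_ : x ^+ 4 = (x ^+ 2) ^+ 2); last by ring.
set y := x ^+ 2 in x2 *; nra.
Qed.

End normal_cdf.

(** * Taylor estimates for the normal distribution function *)

Lemma is_derive_within_continuous (R : realType) (g dg : R -> R) (A : set R) :
  (forall t : R, is_derive t 1 g (dg t)) -> {within A, continuous g}.
Proof.
move=> dgE; apply: continuous_subspaceT => t.
by apply/differentiable_continuous/derivable1_diffP.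
Qed.

(** Two applications of the mean value theorem; the factor 1/2 of the sharp remainder is given up,
    as constants are immaterial here. *)
Lemma taylor01_order1 (R : realType) (f f1 f2 : R -> R) (K : R) :
  (forall t : R, is_derive t 1 f (f1 t)) ->
  (forall t : R, is_derive t 1 f1 (f2 t)) ->
  (forall t, 0 <= t <= 1 -> `|f2 t| <= K) ->
  `|f 1 - f 0 - f1 0| <= K.
Proof.
move=> df df1 f2K.
have [c] := MVT_segment ler01 (fun x _ => df x)
  (is_derive_within_continuous df).
rewrite in_itv/= => /andP[c0 c1] ->.
have [e] := MVT_segment c0 (fun x _ => df1 x) (is_derive_within_continuous df1).
rewrite in_itv/= => /andP[e0 ec].
rewrite !subr0 mulr1 => ->; rewrite normrM (ger0_norm c0).
have := f2K e; rewrite e0 (le_trans ec c1) => /(_ isT) f2e.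
by rewrite (le_trans _ f2e)// ler_piMr.
Qed.

Lemma taylor01_order2 (R : realType) (f f1 f2 f3 : R -> R) (K : R) :
  (forall t : R, is_derive t 1 f (f1 t)) ->
  (forall t : R, is_derive t 1 f1 (f2 t)) ->
  (forall t : R, is_derive t 1 f2 (f3 t)) ->
  (forall t, 0 <= t <= 1 -> `|f3 t| <= K) ->
  `|f 1 - f 0 - f1 0 - f2 0 / 2| <= K.
Proof.
move=> df df1 df2 f3K.
(* Subtracting the quadratic part leaves the second derivative [f2 t - f2 0], which [K] bounds on
   the unit interval by the mean value theorem. *)
have := @taylor01_order1 R (fun t => f t - f2 0 / 2 * t ^+ 2)
  (fun t => f1 t - f2 0 * t) (fun t => f2 t - f2 0) K.
rewrite expr1n expr0n/= mulr1 !mulr0 !subr0 => h.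
rewrite (_ : _ - _ = f 1 - f2 0 / 2 - f 0 - f1 0); last by ring.
apply: h => [t|t|t /andP[t0 t1]].
- by apply: is_derive_eq; rewrite /GRing.scale/=; lra.
- by apply: is_derive_eq; rewrite /GRing.scale/=; lra.
- have [e] := MVT_segment t0 (fun x _ => df2 x) (is_derive_within_continuous df2).
  rewrite in_itv/= subr0 => /andP[e0 et] ->; rewrite normrM (ger0_norm t0).
  have := f3K e; rewrite e0 (le_trans et t1) => /(_ isT) f3e.
  by rewrite (le_trans _ f3e)// ler_piMr.
Qed.

Lemma is_derive_comp_affine (R : realType) (g dg : R -> R) (a b : R) :
  (forall t : R, is_derive t 1 g (dg t)) ->
  forall t : R, is_derive t 1 (fun u => g (a + b * u)) (b * dg (a + b * t)).
Proof.
move=> dgE t.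
have d1 : is_derive t 1 (fun u : R => a + b * u) b.
  by apply: is_derive_eq; rewrite /GRing.scale/=; lra.
have := @is_derive1_comp R g (fun u : R => a + b * u) t (dg (a + b * t)) b _ d1.
by rewrite [in X in _ -> X]mulrC; exact.
Qed.

Lemma is_deriveMr (R : realType) (g dg : R -> R) (b : R) :
  (forall t : R, is_derive t 1 g (dg t)) ->
  forall t : R, is_derive t 1 (fun u => b * g u) (b * dg t).
Proof.
move=> dgE t; have := dgE t => dgt.
by apply: is_derive_eq; rewrite /GRing.scale/=; lra.
Qed.

Section normal_cdf_expansion.
Variable R : realType.
Implicit Types x y e p a : R.
Local Notation Phi := (@normal_cdf R).
Local Notation phi := (@normal_pdf R 0 1).
Local Notation K := (16 * @normal_peak R 1).

Lemma normal_pdf_moment j x : (j <= 4)%N -> `|x| ^+ j * phi x <= K.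
Proof.
move=> j4; apply: le_trans (normal_pdf_bound x).
apply: ler_wpM2r; first exact: normal_pdf_ge0.
have x40 : 0 <= x ^+ 4 by rewrite (_ : x ^+ 4 = (x ^+ 2) ^+ 2) ?sqr_ge0; last ring.
have [x1|x1] := lerP `|x| 1.
  by rewrite (@le_trans _ _ 1) ?exprn_ile1// lerDl.
apply: (@le_trans _ _ (`|x| ^+ 4)); first exact: (ler_weXn2l (ltW x1) j4).
by rewrite -normrX (ger0_norm x40) lerDr.
Qed.

Lemma is_derive_normal_pdf1 x :
  is_derive x 1 (fun y => - y * phi y) ((x ^+ 2 - 1) * phi x).
Proof.
have := is_derive_normal_pdf x => dphi.
by apply: is_derive_eq; rewrite /GRing.scale/=; lra.
Qed.

Lemma normal_pdf2_bound x : `|(x ^+ 2 - 1) * phi x| <= K.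
Proof.
apply: le_trans (normal_pdf_bound x); rewrite normrM.
rewrite (ger0_norm (normal_pdf_ge0 _ _ _)); apply: ler_wpM2r.
  exact: normal_pdf_ge0.
rewrite ler_norml; have := sqr_ge0 x; have := sqr_ge0 (x ^+ 2 - 1).
by rewrite (_ : x ^+ 4 = (x ^+ 2) ^+ 2); [nra|ring].
Qed.

Lemma normal_cdf_taylor2 x a :
  `|Phi (x + a) - Phi x - a * phi x + a ^+ 2 / 2 * (x * phi x)|
     <= K * `|a| ^+ 3.
Proof.
have := @taylor01_order2 R (fun t => Phi (x + a * t))
  (fun t => a * phi (x + a * t))
  (fun t => a ^+ 2 * (- (x + a * t) * phi (x + a * t)))
  (fun t => a ^+ 3 * (((x + a * t) ^+ 2 - 1) * phi (x + a * t)))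
  (K * `|a| ^+ 3).
rewrite !mulr1 !mulr0 !addr0.
rewrite (_ : _ - _ - _ - _ =
  Phi (x + a) - Phi x - a * phi x + a ^+ 2 / 2 * (x * phi x)); last by lra.
apply.
- exact: is_derive_comp_affine (@is_derive_normal_cdf R).
- move=> t; rewrite expr2 -mulrA.
  exact: is_deriveMr a (is_derive_comp_affine x a (@is_derive_normal_pdf R)) t.
- move=> t; rewrite [a ^+ 3]exprSr -[_ * a * _]mulrA.
  exact: is_deriveMr (a ^+ 2) (is_derive_comp_affine x a is_derive_normal_pdf1) t.
- move=> t _; rewrite normrM normrX mulrC; apply: ler_wpM2r => //.
  exact: normal_pdf2_bound.
Qed.

Lemma normal_pdf1_lipschitz x a :
  `|(x + a) * phi (x + a) - x * phi x| <= K * `|a|.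
Proof.
wlog a0 : x a / 0 <= a => [h|].
  have [|/ltW a0] := leP 0 a; first exact: h.
  have := h (x + a) (- a); rewrite oppr_ge0 => /(_ a0).
  by rewrite addrK distrC normrN.
have [|c _] := @MVT_segment R (fun y => - y * phi y) (fun y => (y ^+ 2 - 1) * phi y)
  x (x + a) _ (fun y _ => is_derive_normal_pdf1 y)
  (is_derive_within_continuous is_derive_normal_pdf1).
  by rewrite lerDl.
rewrite (_ : x + a - x = a); last by ring.
rewrite -[X in `|X|]opprK normrN => h.
rewrite (_ : - _ = ((c ^+ 2 - 1) * phi c) * a); last by rewrite -h; ring.
by rewrite normrM ler_wpM2r// normal_pdf2_bound.
Qed.

(** The equation says that [rho] is (1 - e)^(-1/2), hence 1 + e/2 <= rho <= 1 + e/2 + e^2, by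
    comparing squares. The bound is uniform in [x] because the factors of [x] produced by the
    rescaling are absorbed by a moment of the density. *)
Lemma normal_cdf_scale (x e rho : R) : 0 <= e <= 1 / 2 -> 0 <= rho ->
  rho ^+ 2 * (1 - e) = 1 ->
  `|Phi (x * rho) - Phi x - e / 2 * (x * phi x)| <= 2 * K * e ^+ 2.
Proof.
move=> /andP[e0 e1] rho0 rhoe.
have c0 : 0 < K by rewrite mulr_gt0// normal_peak_gt0// oner_eq0.
have lt_sqr_mul (a b : R) : 0 <= a -> a < b -> a ^+ 2 * (1 - e) < b ^+ 2 * (1 - e).
  move=> a0 ab; rewrite ltr_pM2r; last lra.
  by rewrite ltr_pXn2r// nnegrE (le_trans a0)// ltW.
have rho1 : 1 + e / 2 <= rho.
  rewrite leNgt; apply/negP => /(lt_sqr_mul _ _ rho0).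
  rewrite rhoe (_ : _ * _ = 1 - e ^+ 2 * (3 / 4 + e / 4)); last by field.
  apply/negP; rewrite -leNgt gerBl mulr_ge0 ?sqr_ge0//; lra.
have rho2 : rho <= 1 + e / 2 + e ^+ 2.
  have e2 : 0 <= e ^+ 2 by exact: sqr_ge0.
  rewrite leNgt; apply/negP => /lt_sqr_mul.
  rewrite rhoe addr_ge0//; last lra.
  move=> /(_ isT); apply/negP; rewrite -leNgt.
  rewrite (_ : _ * _ = 1 + e ^+ 2 * (5 / 4 * (1 - e) - e * e ^+ 2)); last by field.
  by rewrite lerDl mulr_ge0//; nra.
have := @taylor01_order1 R (fun t => Phi (x + x * (rho - 1) * t))
  (fun t => x * (rho - 1) * phi (x + x * (rho - 1) * t))
  (fun t => (x * (rho - 1)) ^+ 2 *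
     (- (x + x * (rho - 1) * t) * phi (x + x * (rho - 1) * t)))
  (K * (rho - 1) ^+ 2).
rewrite !mulr1 !mulr0 !addr0.
rewrite (_ : x + x * (rho - 1) = x * rho); last by ring.
set A := Phi _ - Phi _ - _ => h.
have {}h : `|A| <= K * (rho - 1) ^+ 2.
  apply: h.
  - exact: is_derive_comp_affine (@is_derive_normal_cdf R).
  - move=> t; rewrite expr2 -mulrA.
    exact: is_deriveMr _ (is_derive_comp_affine x _ (@is_derive_normal_pdf R)) t.
  - move=> t /andP[t0 t1].
    (* Since [v >= 1], replacing [x ^+ 2] by [(x * v) ^+ 2] only increases the bound and leaves the
       third moment at the point [x * v]. *)
    set v := 1 + (rho - 1) * t.
    have v1 : 1 <= v by rewrite /v; nra.
    rewrite (_ : x + x * (rho - 1) * t = x * v); last by rewrite /v; ring.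
    have -> : (x * (rho - 1)) ^+ 2 * (- (x * v) * phi (x * v)) =
       - ((rho - 1) ^+ 2 * (x ^+ 2 * (x * v)) * phi (x * v)) by ring.
    rewrite normrN normrM (ger0_norm (normal_pdf_ge0 _ _ _)) normrM.
    rewrite (ger0_norm (sqr_ge0 _)) -mulrA mulrC ler_wpM2r ?sqr_ge0//.
    apply: le_trans (@normal_pdf_moment 3 (x * v) isT).
    rewrite ler_wpM2r ?normal_pdf_ge0//.
    rewrite normrM (ger0_norm (sqr_ge0 _)) (exprSr _ 2) ler_wpM2r//.
    rewrite -normrX (ger0_norm (sqr_ge0 _)) exprMn ler_peMr ?sqr_ge0//.
    by rewrite exprn_ege1.
rewrite (_ : _ - _ - _ = A + (rho - 1 - e / 2) * (x * phi x)); last first.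
  by rewrite /A; ring.
apply: le_trans (ler_normD _ _) _.
rewrite [leRHS](_ : _ = K * e ^+ 2 + K * e ^+ 2); last by ring.
apply: lerD.
  by apply: le_trans h _; rewrite ler_pM2l//; nra.
rewrite normrM mulrC ler_pM//.
  rewrite normrM (ger0_norm (normal_pdf_ge0 _ _ _)).
  exact: (@normal_pdf_moment 1 x isT).
rewrite ger0_norm; lra.
Qed.

(* A centred step of variance [p (1 - p) e ^ 2], compensated up to
   [p ^ 2 e ^ 2] by the decrease of variance [e ^ 2] after a jump: [rho]
   rescales to the variance [1 - e ^ 2]. *)
Lemma normal_cdf_step (p x e rho : R) : 0 <= p <= 1 -> 0 <= e -> e ^+ 2 <= 1 / 2 ->
  0 <= rho -> rho ^+ 2 * (1 - e ^+ 2) = 1 ->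
  `|(1 - p) * Phi (x - p * e) + p * Phi ((x + (1 - p) * e) * rho) - Phi x|
  <= 6 * K * ((p * e) ^+ 2 + p * e ^+ 3).
Proof.
move=> /andP[p0 p1] e0 e2 rho0 rhoe.
have K0 : 0 < K by rewrite mulr_gt0// normal_peak_gt0// oner_eq0.
have e1 : e <= 1 by nra.
have := normal_cdf_taylor2 x (- (p * e)); rewrite mulNr opprK sqrrN normrN.
set R1 := _ + _ => R1K.
have := normal_cdf_taylor2 x ((1 - p) * e).
set X := x + (1 - p) * e; set R3 := _ + _ => R3K.
have := @normal_cdf_scale X (e ^+ 2) rho; rewrite sqr_ge0 e2.
move=> /(_ isT rho0 rhoe).
set R2 := _ - _ => R2K.
have := normal_pdf1_lipschitz x ((1 - p) * e); rewrite -/X.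
set R4 := _ - _ => R4K.
have psiK : `|x * phi x| <= K.
  rewrite normrM (ger0_norm (normal_pdf_ge0 _ _ _)).
  exact: (@normal_pdf_moment 1 x isT).
have pe0 : 0 <= p * e by rewrite mulr_ge0.
have qe0 : 0 <= (1 - p) * e by rewrite mulr_ge0// subr_ge0.
(* [R1] and [R3] are the Taylor errors of the two moves, [R2] that of the rescaling, and [R4]
   carries [x * phi x] from [X] back to [x]. First-order terms cancel by centring. In second order
   the variance p (1 - p) e^2 meets the compensation p e^2, which leaves the last term. *)
rewrite (_ : _ - Phi x = (1 - p) * R1 + p * R3 + p * R2 + p * (e ^+ 2 / 2 * R4)
  + (p * e) ^+ 2 / 2 * (x * phi x)); last by rewrite /R1 /R2 /R3 /R4 /X; field.
have e3 : 0 <= K * (p * e ^+ 3).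
  by apply: mulr_ge0; [exact: ltW|rewrite mulr_ge0 ?exprn_ge0].
have h1 : `|(1 - p) * R1| <= K * (p * e ^+ 3).
  rewrite normrM ger0_norm ?subr_ge0//.
  apply: (@le_trans _ _ `|R1|); first by rewrite ler_piMl// lerBlDr lerDl.
  apply: le_trans R1K _; rewrite ler_pM2l// ger0_norm// exprMn.
  by rewrite ler_wpM2r ?exprn_ge0// exprS ler_piMr ?exprn_ile1.
have h3 : `|p * R3| <= K * (p * e ^+ 3).
  rewrite normrM ger0_norm// mulrCA ler_wpM2l//.
  apply: le_trans R3K _; rewrite ler_pM2l// ger0_norm//.
  by rewrite ler_pXn2r// ?nnegrE//; nra.
have h2 : `|p * R2| <= 2 * (K * (p * e ^+ 3)).
  rewrite normrM (ger0_norm p0).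
  rewrite [leRHS](_ : _ = p * (2 * K * e ^+ 3)); last by ring.
  rewrite ler_wpM2l//; apply: le_trans R2K _.
  rewrite ler_pM2l; last by apply: mulr_gt0.
  by rewrite [leLHS](_ : _ = e ^+ 3 * e); [rewrite ler_piMr// exprn_ge0|ring].
have h4 : `|p * (e ^+ 2 / 2 * R4)| <= K * (p * e ^+ 3).
  rewrite normrM (ger0_norm p0) mulrCA ler_wpM2l// normrM.
  rewrite ger0_norm ?divr_ge0 ?sqr_ge0//.
  rewrite (ger0_norm qe0) in R4K.
  have {}R4K : `|R4| <= K * e.
    by apply: le_trans R4K _; rewrite ler_pM2l//; nra.
  apply: (@le_trans _ _ (e ^+ 2 / 2 * (K * e))).
    by rewrite ler_wpM2l// divr_ge0// sqr_ge0.
  have : 0 <= K * e ^+ 3 by apply: mulr_ge0; [exact: ltW|exact: exprn_ge0].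
  by lra.
have h5 : `|(p * e) ^+ 2 / 2 * (x * phi x)| <= (p * e) ^+ 2 / 2 * K.
  by rewrite normrM ger0_norm ?ler_wpM2l// divr_ge0// sqr_ge0.
have h6 : 0 <= K * (p * e) ^+ 2 by apply: mulr_ge0; [exact: ltW|exact: sqr_ge0].
move: h1 h3 h2 h4 h5; set A := (1 - p) * R1; set B := p * R3; set C := p * R2.
set D := p * (_ * R4); set E := _ * (x * phi x) => h1 h3 h2 h4 h5.
have t1 := ler_normD (A + B + C + D) E.
have t2 := ler_normD (A + B + C) D.
have t3 := ler_normD (A + B) C.
have t4 := ler_normD A B.
lra.
Qed.

End normal_cdf_expansion.

Section normal_cdf_limits.
Variable R : realType.
Implicit Types x y : R.
Local Notation Phi := (@normal_cdf R).

Lemma normal_cdf_ge0 x : 0 <= Phi x.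
Proof. by rewrite fine_ge0. Qed.

Lemma normal_cdf_le1 x : Phi x <= 1.
Proof. by rewrite -lee_fin -normal_cdfE probability_le1. Qed.

Lemma normal_cdf_nondecreasing : {homo Phi : x y / x <= y}.
Proof.
move=> x y xy; rewrite -lee_fin -!normal_cdfE.
by rewrite le_measure ?inE//; exact: subitvPr.
Qed.

Lemma normal_cdf_continuous : continuous Phi.
Proof.
move=> x; apply: differentiable_continuous; apply/derivable1_diffP.
by have := is_derive_normal_cdf x; case.
Qed.

Lemma normal_cdf_tails (e : R) : 0 < e ->
  exists2 L : R, 1 <= L & Phi (- L) <= e /\ 1 - e <= Phi L.
Proof.
move=> e0.
(* The identity, seen as a random variable under the normal law, has [Phi] as its distribution
   function; this gives the limits at both infinities. *)
pose id_R : measurableTypeR R -> R := idfun.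
pose X : {RV normal_prob 0 1 >-> R} := HB.pack id_R
  (@isMeasurableFun.Build _ _ _ _ id_R (@measurable_id _ _ setT)).
have cX : cdf X = EFin \o Phi by apply/funext => r; rewrite /= -normal_cdfE.
have := cvg_cdfNy0 X; have := cvg_cdfy1 X; rewrite cX.
move=> /fine_cvgP[_ /cvgrPdist_le/(_ _ e0) c1].
move=> /fine_cvgP[_ /cvgrPdist_le/(_ _ e0) c0].
have [A [_ hA]] := c1; have [B [_ hB]] := c0.
pose L := Num.max 1 (Num.max (A + 1) (1 - B)); exists L.
  by rewrite /L le_max lexx.
have AL : A < L by rewrite /L !lt_max; apply/orP; right; rewrite ltrDl ltr01.
have BL : - L < B by rewrite ltrNl /L !lt_max ltrDr ltr01 !orbT.
have := hA _ AL; have := hB _ BL.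
rewrite /= sub0r normrN ger0_norm ?normal_cdf_ge0// => ->.
by rewrite ler_norml => /andP[_ h]; split => //; lra.
Qed.
End normal_cdf_limits.

(** * The chain of ranks *)

Section rank_chain.
Variables (R : realType) (r : nat -> nat).
Hypothesis r_gt0 : forall k, (0 < r k)%N.
Hypothesis r_le : forall k, (r k <= k.+1)%N.

Definition jump_prob (n k : nat) : R := (r k)%:R / n.+1%:R.

(* The law of the number of accepted candidates among the first [n]: the next
   one is accepted with probability [jump_prob n k] when [k] are accepted. *)
Fixpoint chain_law (n k : nat) : R :=
  if n is n'.+1 then
    chain_law n' k * (1 - jump_prob n' k) +
    (if k is k'.+1 then chain_law n' k' * jump_prob n' k' else 0)
  else (k == 0%N)%:R.

Definition chain_mean (n : nat) (F : nat -> R) : R :=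
  \sum_(k < n.+1) chain_law n k * F k.

Lemma jump_prob_ge0 n k : 0 <= jump_prob n k.
Proof. exact: divr_ge0. Qed.

Lemma jump_prob_le1 n k : (k <= n)%N -> jump_prob n k <= 1.
Proof.
move=> kn; rewrite ler_pdivrMr ?ltr0n// mul1r ler_nat.
exact: leq_trans (r_le k) _.
Qed.

Lemma chain_law_gt n k : (n < k)%N -> chain_law n k = 0.
Proof.
elim: n k => [|n ih] [|k]//= nk.
by rewrite !ih ?mul0r ?addr0// ltnW.
Qed.

Lemma chain_law_ge0 n k : 0 <= chain_law n k.
Proof.
elim: n k => [|n ih] k /=; first exact: ler0n.
apply: addr_ge0; last by case: k => // k; rewrite mulr_ge0 ?jump_prob_ge0.
(* For [k > n] the factor [1 - jump_prob n k] can be negative, but the law vanishes there. *)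
have [kn|nk] := leqP k n; last by rewrite chain_law_gt// mul0r.
by rewrite mulr_ge0 ?subr_ge0 ?jump_prob_le1.
Qed.

(** Moves a step of the chain from the law to the test function; all later estimates of [chain_mean]
    go through this form. *)
Lemma chain_mean_step n F : chain_mean n.+1 F =
  chain_mean n (fun k => (1 - jump_prob n k) * F k + jump_prob n k * F k.+1).
Proof.
rewrite /chain_mean /=.
under eq_bigr do rewrite mulrDl.
rewrite big_split/= big_ord_recr/= chain_law_gt// !mul0r addr0.
rewrite [X in _ + X]big_ord_recl/= mul0r add0r -big_split/=.
by apply: eq_bigr => k _; rewrite /bump /= add0n; ring.
Qed.

Lemma le_chain_mean n F G : (forall k, (k <= n)%N -> F k <= G k) ->
  chain_mean n F <= chain_mean n G.
Proof.
move=> FG; apply: ler_sum => k _; rewrite ler_wpM2l ?chain_law_ge0//.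
by rewrite FG// -ltnS.
Qed.

Lemma chain_mean_const n (a : R) : chain_mean n (fun=> a) = a.
Proof.
elim: n => [|n ih]; first by rewrite /chain_mean big_ord1 /= mul1r.
rewrite chain_mean_step -[RHS]ih /chain_mean; apply: eq_bigr => k _.
by congr (_ * _); ring.
Qed.

Lemma chain_meanD n F G :
  chain_mean n (fun k => F k + G k) = chain_mean n F + chain_mean n G.
Proof. by rewrite /chain_mean -big_split; apply: eq_bigr => k _; rewrite mulrDr. Qed.

Lemma chain_meanZ n (a : R) F :
  chain_mean n (fun k => a * F k) = a * chain_mean n F.
Proof. by rewrite /chain_mean big_distrr; apply: eq_bigr => k _; rewrite mulrCA. Qed.

Lemma chain_supermartingale (F : nat -> nat -> R) n :
  (forall j k, (j < n)%N -> (k <= j)%N ->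
    (1 - jump_prob j k) * F j.+1 k + jump_prob j k * F j.+1 k.+1 <= F j k) ->
  chain_mean n (F n) <= F 0%N 0%N.
Proof.
elim: n => [|n ih] hF; first by rewrite /chain_mean big_ord1 /= mul1r.
rewrite chain_mean_step; apply: (@le_trans _ _ (chain_mean n (F n))).
  by apply: le_chain_mean => k kn; exact: hF.
by apply: ih => j k jn kj; apply: hF => //; exact: ltnW.
Qed.

Definition reach_prob (n m : nat) : R := chain_mean n (fun k => (m <= k)%N%:R).

Lemma reach_prob_le1 n m : reach_prob n m <= 1.
Proof.
rewrite -[leRHS](chain_mean_const n); apply: le_chain_mean => k _.
by rewrite lern1 leq_b1.
Qed.

Lemma reach_prob_ge0 n m : 0 <= reach_prob n m.
Proof.
by rewrite -[leLHS](chain_mean_const n); apply: le_chain_mean => k _.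
Qed.

Lemma reach_prob0 m : (0 < m)%N -> reach_prob 0 m = 0.
Proof.
by move=> m0; rewrite /reach_prob /chain_mean big_ord1 /= leqNgt m0 mulr0.
Qed.

Lemma reach_prob_nondecreasing m : {homo reach_prob^~ m : a b / (a <= b)%N >-> a <= b}.
Proof.
apply: homo_leq => // [a b c|n]; first exact: le_trans.
rewrite /reach_prob chain_mean_step; apply: le_chain_mean => k kn.
have := jump_prob_le1 kn; have := jump_prob_ge0 n k.
have : (m <= k)%N%:R <= (m <= k.+1)%N%:R :> R.
  by rewrite ler_nat; case: (leqP m k) => // mk; rewrite (leqW mk).
set a := (m <= k)%N%:R; set b := (m <= _)%N%:R; nra.
Qed.

Lemma series_harmonicS n :
  series (@harmonic R) n.+1 = series harmonic n + n.+1%:R^-1.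
Proof. by rewrite /series/= big_nat_recr. Qed.

Lemma series_harmonic_nondecreasing : nondecreasing_seq (series (@harmonic R)).
Proof.
by apply/nondecreasing_seqP => n; rewrite series_harmonicS lerDl invr_ge0.
Qed.

(** As [r k >= 1], a jump at time [j] has probability at least 1/(j + 1). So the mean of
    [minn M_n m] is at least the sum over [j < n] of P(M_j < m)/(j + 1), hence at least P(M_n < m)
    times the harmonic sum by monotonicity. It is at most [m], while the harmonic sum diverges. *)
Lemma reach_prob_cvg1 m : reach_prob n m @[n --> \oo] --> (1 : R).
Proof.
have bound n : (1 - reach_prob n m) * series harmonic n <= m%:R.
  have : chain_mean n (fun k => (minn k m)%:R) >=
         \sum_(j < n) (1 - reach_prob j m) / j.+1%:R.
    elim: n => [|n ih].
      by rewrite big_ord0 /chain_mean big_ord1/= mul1r.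
    rewrite big_ord_recr/= chain_mean_step.
    apply: le_trans (lerD ih (lexx _)) _.
    have -> : (1 - reach_prob n m) / n.+1%:R =
        chain_mean n (fun k => n.+1%:R^-1 * (1 + -1 * (m <= k)%N%:R)).
      by rewrite chain_meanZ chain_meanD chain_meanZ chain_mean_const mulN1r mulrC.
    rewrite -chain_meanD.
    apply: le_chain_mean => k kn.
    have [mk|km] := leqP m k.
      rewrite (minn_idPr (leqW mk)).
      by rewrite mulN1r subrr mulr0 addr0; lra.
    rewrite (minn_idPl km) mulr0 addr0 mulr1.
    rewrite -[k.+1%:R]natr1 [leRHS](_ : _ = k%:R + jump_prob n k); last by ring.
    by rewrite lerD2l /jump_prob ler_peMl ?invr_ge0// ler1n.
  move=> le_mean; apply: le_trans (le_trans le_mean _); last first.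
    rewrite -[leRHS](chain_mean_const n); apply: le_chain_mean => k _.
    by rewrite ler_nat geq_minr.
  rewrite /series/= big_mkord big_distrr/=; apply: ler_sum => j _.
  rewrite ler_wpM2r ?invr_ge0// lerD2l lerN2.
  by apply: reach_prob_nondecreasing; exact: ltnW.
have cvg_harm : series (@harmonic R) n @[n --> \oo] --> +oo.
  apply: nondecreasing_dvgn_lt; last exact: dvg_harmonic.
  exact: series_harmonic_nondecreasing.
apply/cvgrPdist_le => e e0.
have /cvgryPge/(_ (m%:R / e)) := cvg_harm.
apply: filterS2 (nbhs_infty_gt 0%N) => n n0 nH.
have H0 : 0 < series (@harmonic R) n.
  case: n n0 {nH} => // n _; rewrite series_harmonicS ltr_wpDl ?invr_gt0 ?ltr0n//.
  by apply: sumr_ge0 => i _; exact: harmonic_ge0.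
rewrite ger0_norm ?subr_ge0 ?reach_prob_le1//.
rewrite -(ler_pM2r H0); apply: le_trans (bound n) _.
by rewrite mulrC -ler_pdivrMr.
Qed.
End rank_chain.

(** * Comparison of the chain with its Gaussian value *)

Section chain_clt.
Variables (R : realType) (r : nat -> nat).
Hypothesis r_gt0 : forall k, (0 < r k)%N.
Hypothesis r_le : forall k, (r k <= k.+1)%N.
Local Notation Phi := (@normal_cdf R).
Local Notation K := (16 * @normal_peak R 1).
Local Notation H := (series (@harmonic R)).
Local Notation jump_prob := (@jump_prob R r).
Local Notation chain_mean := (@chain_mean R r).
Local Notation reach_prob := (@reach_prob R r).

Definition inv_sum (k : nat) : R := \sum_(i < k) (r i)%:R^-1.
Definition inv_sqr_sum (k : nat) : R := \sum_(i < k) ((r i)%:R ^+ 2)^-1.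
Local Notation S := inv_sum.
Local Notation V := inv_sqr_sum.

Lemma inv_sqr_sum_nondecreasing : {homo V : a b / (a <= b)%N >-> a <= b}.
Proof.
apply: homo_leq => // [a b c|n]; first exact: le_trans.
by rewrite /V big_ord_recr/= lerDl invr_ge0 exprn_ge0.
Qed.

(* The gap of the variances is the remaining variance: this is the conditional
   probability of falling below [c] if the remaining waiting times were
   Gaussian, smoothed at scale [s]. *)
Definition gauss_value (s c : R) (m j k : nat) : R :=
  Phi ((c - H j + S k) / Num.sqrt (s ^+ 2 + V m - V k)).

Definition step_err (s : R) (j k : nat) : R :=
  6 * K * ((j.+1%:R ^+ 2)^-1 / s ^+ 2 +
           jump_prob j k * ((r k)%:R ^+ 2)^-1 / s ^+ 3).

(** An instance of [normal_cdf_step] with [p = jump_prob j k], [q = 1 / r k], [e = q / w] and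
    [rho = w / w']. The product [p * q] is the increment of the harmonic sum, so staying shifts the
    argument by [- p * e] and jumping by [(1 - p) * e]. The bound [2 <= s] makes
    [e ^+ 2 <= 1 / 2]. *)
Lemma gauss_value_step (s c : R) (m j k : nat) : 2 <= s -> (k < m)%N ->
  (k <= j)%N ->
  `|(1 - jump_prob j k) * gauss_value s c m j.+1 k +
    jump_prob j k * gauss_value s c m j.+1 k.+1 - gauss_value s c m j k|
  <= step_err s j k.
Proof.
move=> s2 km kj.
have K0 : 0 < K by rewrite mulr_gt0// normal_peak_gt0// oner_eq0.
have rk0 : 0 < (r k)%:R :> R by rewrite ltr0n.
pose q : R := (r k)%:R^-1.
have q0 : 0 < q by rewrite invr_gt0.
have q1 : q <= 1 by rewrite invf_le1// ler1n.
have jq : jump_prob j k * q = j.+1%:R^-1.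
  by rewrite /jump_prob /q mulrAC mulfV ?gt_eqF// mul1r.
have VS : V k.+1 = V k + q ^+ 2 by rewrite /V big_ord_recr/= -exprVn.
have SS : S k.+1 = S k + q by rewrite /S big_ord_recr.
have VkS : V k.+1 <= V m by exact: inv_sqr_sum_nondecreasing.
set w := Num.sqrt (s ^+ 2 + V m - V k).
set w' := Num.sqrt (s ^+ 2 + V m - V k.+1).
have ss : 2 * 2 <= s ^+ 2 by rewrite expr2 ler_pM.
have q2 : 0 < q ^+ 2 by rewrite exprn_gt0.
have q21 : q ^+ 2 <= 1 by rewrite exprn_ile1// ltW.
have w2 : w ^+ 2 = s ^+ 2 + V m - V k by rewrite sqr_sqrtr//; lra.
have w'2 : w' ^+ 2 = w ^+ 2 - q ^+ 2 by rewrite w2 sqr_sqrtr; lra.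
have sw' : s <= w'.
  rewrite -(@ler_pXn2r _ 2)// ?nnegrE ?sqrtr_ge0//; last lra.
  rewrite w'2 w2; lra.
have w'0 : 0 < w' by lra.
have sw : s <= w.
  rewrite -(@ler_pXn2r _ 2)// ?nnegrE ?sqrtr_ge0//; last lra.
  rewrite w2; lra.
have w0 : 0 < w by lra.
have s0 : 0 < s by lra.
have p01 : 0 <= jump_prob j k <= 1 by rewrite jump_prob_ge0 jump_prob_le1.
have e0 : 0 <= q / w by rewrite divr_ge0// ltW.
have eE : (q / w) ^+ 2 = q ^+ 2 / w ^+ 2 by rewrite expr_div_n.
have e2 : (q / w) ^+ 2 <= 1 / 2.
  rewrite eE ler_pdivrMr ?exprn_gt0//; rewrite w2; lra.
have rho0 : 0 <= w / w' by rewrite divr_ge0// ltW.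
have rhoe : (w / w') ^+ 2 * (1 - (q / w) ^+ 2) = 1.
  rewrite eE expr_div_n w'2.
  have : w ^+ 2 - q ^+ 2 != 0 by rewrite -w'2 gt_eqF// exprn_gt0.
  have : w != 0 by rewrite gt_eqF.
  by move=> wn wqn; field; rewrite wn wqn.
have := normal_cdf_step ((c - H j + S k) / w) p01 e0 e2 rho0 rhoe.
rewrite /gauss_value -/w -/w'.
have -> : (c - H j + S k) / w - jump_prob j k * (q / w) =
    (c - H j.+1 + S k) / w.
  by rewrite mulrA jq -mulrBl series_harmonicS; congr (_ / _); ring.
have -> : ((c - H j + S k) / w + (1 - jump_prob j k) * (q / w)) * (w / w') =
    (c - H j.+1 + S k.+1) / w'.
  rewrite SS series_harmonicS mulrBl mul1r [_ * (q / w)]mulrA jq.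
  by field; rewrite nat1r pnatr_eq0 !gt_eqF.
move=> h; apply: le_trans h _; rewrite /step_err ler_pM2l; last by apply: mulr_gt0.
apply: lerD.
  rewrite mulrA jq exprMn !exprVn ler_wpM2l ?invr_ge0 ?exprn_ge0//.
  by rewrite lef_pV2 ?posrE ?exprn_gt0// ler_pXn2r// nnegrE ltW.
(* The cube of [q] is weakened to its square, so that these errors add up to a multiple of [V m]. *)
rewrite -[leRHS]mulrA ler_wpM2l ?jump_prob_ge0// expr_div_n -exprVn -/q.
apply: ler_pM.
- by rewrite exprn_ge0// ltW.
- by rewrite invr_ge0 exprn_ge0// ltW.
- by rewrite exprS ler_piMl// exprn_ge0// ltW.
- by rewrite lef_pV2 ?posrE ?exprn_gt0// ler_pXn2r// nnegrE ltW.
Qed.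

Lemma sum_inv_sqr_le2 n : \sum_(j < n) (j.+1%:R ^+ 2)^-1 <= 2 :> R.
Proof.
case: n => [|n]; first by rewrite big_ord0.
apply: (@le_trans _ _ (2 - n.+1%:R^-1)); last by rewrite gerBl invr_ge0.
elim: n => [|n ih]; first by rewrite big_ord1 expr1n invr1; lra.
rewrite big_ord_recr/=; apply: le_trans (lerD ih (lexx _)) _.
have n1 : 0 < n.+1%:R :> R by rewrite ltr0n.
rewrite -[n.+2%:R]natr1; set x : R := n.+1%:R in n1 *.
rewrite -subr_ge0 (_ : _ - _ = (x * (x + 1) ^+ 2)^-1).
  by rewrite invr_ge0 mulr_ge0 ?sqr_ge0// ltW.
field; apply/andP; split; rewrite gt_eqF//; lra.
Qed.

Definition total_err (s : R) (m : nat) : R :=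
  6 * K * (2 / s ^+ 2 + V m / s ^+ 3).

(* Partial sums of [step_err]: the expected number of jumps out of each [k] is
   at most one. *)
Let err (s : R) (m j k : nat) : R :=
  6 * K * (\sum_(i < j) (i.+1%:R ^+ 2)^-1 / s ^+ 2 + V (minn k m) / s ^+ 3).

Lemma err_le_total s m j k : 0 < s -> err s m j k <= total_err s m.
Proof.
move=> s0; have K0 : 0 < K by rewrite mulr_gt0// normal_peak_gt0// oner_eq0.
rewrite /err /total_err ler_pM2l; last by apply: mulr_gt0.
rewrite -mulr_suml lerD// ler_pM2r ?invr_gt0 ?exprn_gt0// ?sum_inv_sqr_le2//.
by apply: inv_sqr_sum_nondecreasing; exact: geq_minr.
Qed.

(** Below [m] there is equality: the time sum grows surely, and [V] grows by [1 / r k ^ 2] with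
    probability [jump_prob j k]. From [m] on, [minn] freezes [V]. Subtracting [err] thus absorbs the
    step errors and turns an approximate martingale into a supermartingale. *)
Lemma err_step s m j k : 0 < s -> (k <= j)%N ->
  (1 - jump_prob j k) * err s m j.+1 k + jump_prob j k * err s m j.+1 k.+1
  >= err s m j k + (if (k < m)%N then step_err s j k else 0).
Proof.
move=> s0 kj; have K0 : 0 < K by rewrite mulr_gt0// normal_peak_gt0// oner_eq0.
rewrite /err /step_err !big_ord_recr/=.
set A := \sum_(i < j) _; set a := (j.+1%:R ^+ 2)^-1 / s ^+ 2.
have a0 : 0 <= a by rewrite divr_ge0 ?invr_ge0 ?exprn_ge0// ltW.
case: ltnP => km.
  rewrite (minn_idPl km).
  rewrite [V k.+1]/V big_ord_recr/= -/(V k).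
  rewrite le_eqVlt; apply/orP; left; apply/eqP; field.
  by rewrite pnatr_eq0 -lt0n r_gt0 gt_eqF.
rewrite (minn_idPr (leqW km : (m <= k.+1)%N)) addr0 -mulrDl subrK mul1r.
by rewrite ler_pM2l ?lerD2r ?lerDl//; apply: mulr_gt0.
Qed.

Let err0 s m : err s m 0 0 = 0.
Proof. by rewrite /err min0n /V !big_ord0 !mul0r addr0 mulr0. Qed.

(** The value is frozen at [B] on reaching [m]. Harmonic sums increase, so [B] is the least value
    that [gauss_value] takes at [k = m] up to time [n], and freezing only lowers the function. Paths
    still below [m] at time [n] contribute a nonnegative amount, which is dropped. *)
Lemma chain_clt_upper (s c : R) (m n : nat) : 2 <= s -> (0 < m)%N ->
  reach_prob n m * Phi ((c - H n + S m) / s) <=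
  Phi (c / Num.sqrt (s ^+ 2 + V m)) + total_err s m.
Proof.
move=> s2 m0; have s0 : 0 < s by lra.
set B := Phi (_ / s).
pose F j k := if (k < m)%N then gauss_value s c m j k else B.
have F0 : F 0%N 0%N = Phi (c / Num.sqrt (s ^+ 2 + V m)).
  by rewrite /F m0 /gauss_value /series/= big_nil /S /V !big_ord0 !subr0 addr0.
have := @chain_supermartingale R r r_le (fun j k => F j k - err s m j k) n _.
rewrite F0 err0 subr0.
move=> h.
apply: (@le_trans _ _ (chain_mean n (fun k => (F n k - err s m n k) + total_err s m))).
  rewrite mulrC -chain_meanZ; apply: le_chain_mean => // k kn.
  have := err_le_total m n k s0.
  have : B * (m <= k)%N%:R <= F n k.
    rewrite /F; case: ltnP => mk; last by rewrite mulr1.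
    by rewrite mulr0 normal_cdf_ge0.
  lra.
rewrite chain_meanD chain_mean_const// lerD2r; apply: h => j k jn kj.
have := err_step m s0 kj.
rewrite /F; case: ltnP => km; last first.
  by rewrite ltnNge (leqW km)/=; lra.
have := gauss_value_step c s2 km kj; rewrite ler_norml => /andP[_ h1].
have : (if (k.+1 < m)%N then gauss_value s c m j.+1 k.+1 else B) <=
       gauss_value s c m j.+1 k.+1.
  (* At [k = m] the remaining scale is exactly [s]. *)
  case: ltnP => // mk; have -> : k.+1 = m by apply/eqP; rewrite eqn_leq km mk.
  rewrite /gauss_value addrK sqrtr_sqr gtr0_norm//.
  apply: normal_cdf_nondecreasing; rewrite ler_pM2r ?invr_gt0// lerD2r lerD2l lerN2.
  exact: series_harmonic_nondecreasing.
move=> /(ler_wpM2l (jump_prob_ge0 R r j k)).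
lra.
Qed.

(** The reverse bound freezes at 1, the largest possible value, and works with [- F]; [b] accounts
    for the paths still below [m] at time [n]. *)
Lemma chain_clt_lower (s c b : R) (m n : nat) : 2 <= s -> (0 < m)%N ->
  (forall k, (k < m)%N -> gauss_value s c m n k <= b) ->
  Phi (c / Num.sqrt (s ^+ 2 + V m)) - total_err s m <= reach_prob n m + b.
Proof.
move=> s2 m0 gb; have s0 : 0 < s by lra.
pose F j k := if (k < m)%N then gauss_value s c m j k else 1.
have F0 : F 0%N 0%N = Phi (c / Num.sqrt (s ^+ 2 + V m)).
  by rewrite /F m0 /gauss_value /series/= big_nil /S /V !big_ord0 !subr0 addr0.
have b0 : 0 <= b by apply: le_trans (gb _ m0); exact: normal_cdf_ge0.
have := @chain_supermartingale R r r_le (fun j k => - F j k - err s m j k) n _.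
rewrite F0 err0 subr0.
move=> h.
have {}h : chain_mean n (fun k => - F n k - err s m n k) <=
    - Phi (c / Num.sqrt (s ^+ 2 + V m)).
  apply: h => j k jn kj.
  have := err_step m s0 kj.
  rewrite /F; case: ltnP => km; last by rewrite ltnNge (leqW km)/=; lra.
  have := gauss_value_step c s2 km kj; rewrite ler_norml => /andP[h1 _].
  have : gauss_value s c m j.+1 k.+1 <=
         (if (k.+1 < m)%N then gauss_value s c m j.+1 k.+1 else 1).
    by case: ifP => // _; exact: normal_cdf_le1.
  move=> /(ler_wpM2l (jump_prob_ge0 R r j k)).
  lra.
have : chain_mean n (fun k => - (m <= k)%N%:R + (- b - total_err s m)) <=
       chain_mean n (fun k => - F n k - err s m n k).
  apply: le_chain_mean => // k kn; have := err_le_total m n k s0.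
  rewrite /F; case: ltnP => mk; last by rewrite mulr1n; lra.
  by have := gb _ mk; rewrite mulr0n; lra.
rewrite chain_meanD chain_mean_const//.
under eq_fun do rewrite -mulN1r.
rewrite chain_meanZ -/(reach_prob n m); lra.
Qed.

End chain_clt.

(** * Choice of the smoothing scale and passage to the limit *)

Section chain_limit.
Variables (R : realType) (r : nat -> nat).
Hypothesis r_gt0 : forall k, (0 < r k)%N.
Hypothesis r_le : forall k, (r k <= k.+1)%N.
Local Notation Phi := (@normal_cdf R).
Local Notation K := (16 * @normal_peak R 1).
Local Notation H := (series (@harmonic R)).
Local Notation S := (@inv_sum R r).
Local Notation V := (@inv_sqr_sum R r).
Local Notation reach_prob := (@reach_prob R r).

Variables (sigma : nat -> R) (t : R) (N : nat -> nat).
Hypothesis sigma_ge0 : forall m, 0 <= sigma m.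
Hypothesis sigma_cvg : sigma m @[m --> \oo] --> +oo.
Hypothesis V_sigma : forall m, sigma m ^+ 2 <= V m <= sigma m ^+ 2 + 1.

Lemma total_err_le (s A : R) m : 1 <= s -> V m <= A * s ^+ 2 ->
  total_err r s m <= 6 * K * ((2 + A) / s).
Proof.
move=> s1 VA; have s0 : 0 < s by lra.
have K0 : 0 < K by rewrite mulr_gt0// normal_peak_gt0// oner_eq0.
rewrite /total_err ler_pM2l; last by apply: mulr_gt0.
rewrite [leRHS]mulrDl lerD//.
  by rewrite ler_pM2l// lef_pV2 ?posrE ?exprn_gt0// expr2 ler_peMl// ltW.
rewrite ler_pdivrMr ?exprn_gt0//.
by rewrite [leRHS](_ : _ = A * s ^+ 2)//; field; rewrite gt_eqF.
Qed.

Lemma near_scale (eps B : R) : 0 < eps -> \forall m \near \oo, B <= eps * sigma m.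
Proof.
move=> eps0; move/cvgryPge : sigma_cvg => /(_ (B / eps)).
by apply: filterS => m; rewrite ler_pdivrMr// mulrC.
Qed.

Lemma near_total_err (eps eta : R) : 0 < eps -> 0 < eta ->
  \forall m \near \oo, total_err r (eps * sigma m) m <= eta.
Proof.
move=> eps0 eta0.
have K0 : 0 < K by rewrite mulr_gt0// normal_peak_gt0// oner_eq0.
(* With [s = eps * sigma m >= 1], the bound [V m <= sigma m ^+ 2 + 1] gives [V m <= A * s ^+ 2], so
   the total error is of order [1 / s]. *)
pose A := eps ^- 2 + 1.
have := near_scale (6 * K * (2 + A) / eta) eps0.
apply: filterS2 (near_scale 1 eps0) => m s1 sB.
have s0 : 0 < eps * sigma m by lra.
apply: le_trans (@total_err_le _ A m s1 _) _.
  have /andP[_ h] := V_sigma m; apply: le_trans h _.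
  rewrite /A mulrDl mul1r exprMn mulrA mulVf ?mul1r; last first.
    by rewrite gt_eqF// exprn_gt0.
  by rewrite lerD2l -exprMn exprn_ege1.
rewrite [leLHS](_ : _ = 6 * K * (2 + A) / (eps * sigma m)); last exact: mulrA.
by rewrite ler_pdivrMr// [leRHS]mulrC -ler_pdivrMr.
Qed.

Lemma start_scale_bounds (s : R) m : 0 <= s ->
  sigma m <= Num.sqrt (s ^+ 2 + V m) <= sigma m + s + 1.
Proof.
move=> s0; have /andP[V1 V2] := V_sigma m; have := sigma_ge0 m => sig0.
have s2 := sqr_ge0 s.
apply/andP; split.
  by rewrite -(ger0_norm sig0) -sqrtr_sqr ler_wsqrtr//; lra.
rewrite -[leRHS]ger0_norm; last by rewrite !addr_ge0.
by rewrite -sqrtr_sqr ler_wsqrtr//; nra.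
Qed.

Lemma start_shift (x s : R) m : 0 <= s ->
  `|x * Num.sqrt (s ^+ 2 + V m) - x * sigma m| <= `|x| * (s + 1).
Proof.
move=> s0; rewrite -mulrBr normrM ler_wpM2l//.
have /andP[h1 h2] := start_scale_bounds m s0.
by rewrite ger0_norm ?subr_ge0//; lra.
Qed.

(** Here [c] is [x] times the initial scale, so that the comparison starts at [Phi x]. [eps] is
    chosen so that the margin [(x - t) * sigma m] equals [s * (|x| + L + 1)]. It covers [L * s] for
    the tail at [m], [|x| * (s + 1)] for replacing the initial scale by [sigma m], and the constant
    2, as soon as [|x| + 2 <= s]. *)
Lemma reach_prob_limsup (x eta : R) : t < x -> 0 < eta ->
  (forall m, N m = 0%N \/ H (N m) - S m <= t * sigma m + 2) ->
  \forall m \near \oo, reach_prob (N m) m * (1 - eta) <= Phi x + eta.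
Proof.
move=> tx eta0 HN.
have [L L1 [_ hL]] := normal_cdf_tails eta0.
pose eps := (x - t) / (`|x| + L + 1).
have xL : 0 < `|x| + L + 1 by have := normr_ge0 x; lra.
have eps0 : 0 < eps by rewrite divr_gt0// subr_gt0.
have near_s := near_scale (`|x| + 2) eps0.
near=> m.
have m0 : (0 < m)%N by near: m; exact: nbhs_infty_gt.
have [->|HNm] := HN m.
  by rewrite reach_prob0// mul0r addr_ge0 ?normal_cdf_ge0// ltW.
have sx : `|x| + 2 <= eps * sigma m by near: m; exact: near_s.
have serr : total_err r (eps * sigma m) m <= eta.
  by near: m; exact: near_total_err.
set s := eps * sigma m in sx serr.
have x0 := normr_ge0 x.
have s0 : 0 <= s by lra.
have sig0 : 0 < sigma m by rewrite -(pmulr_rgt0 _ eps0) -/s; lra.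
have w0 : 0 < Num.sqrt (s ^+ 2 + V m).
  by have /andP[h _] := start_scale_bounds m s0; lra.
have := @chain_clt_upper R r r_gt0 r_le s (x * Num.sqrt (s ^+ 2 + V m)) m (N m) _ m0.
rewrite mulfK ?gt_eqF// => h; apply: (@le_trans _ _ (Phi x + total_err r s m)).
  apply: le_trans (h _); last lra.
  rewrite ler_wpM2l ?reach_prob_ge0//; apply: le_trans hL _.
  apply: normal_cdf_nondecreasing; rewrite ler_pdivlMr; last lra.
  have : `|x * Num.sqrt (s ^+ 2 + V m) - x * sigma m| <= `|x| * (s + 1).
    by apply: start_shift; lra.
  rewrite ler_norml => /andP[h1 _].
  have : (x - t) * sigma m = s * (`|x| + L + 1).
    by rewrite /s /eps; field; rewrite gt_eqF.
  by rewrite mulrBl; nra.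
by rewrite lerD2l.
Unshelve. all: by end_near. Qed.

(** States far below [m] have a large remaining scale; this bound shows that they are at least
    correspondingly far from the target [S m]. *)
Lemma le_inv_sum_diff m k : (k <= m)%N -> V m - V k <= S m - S k.
Proof.
move=> km; suff : {homo (fun k => S k - V k) : a b / (a <= b)%N >-> a <= b}.
  by move=> /(_ _ _ km) /=; lra.
apply: homo_leq => // [a b c|n]; first exact: le_trans.
rewrite /inv_sum /inv_sqr_sum !big_ord_recr/=.
rewrite -exprVn; set q : R := (r n)%:R^-1.
have q0 : 0 <= q by rewrite invr_ge0.
have q1 : q <= 1 by rewrite invf_le1 ?ltr0n// ler1n.
have : q ^+ 2 <= q by nra.
set A := \sum_(i < n) _; set B := \sum_(i < n) _; lra.
Qed.

(** The margin is split as for the upper bound, but now the value at every state [k < m] has to be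
    at most [Phi (- L)], although the scale [w] depends on [k]. *)
Lemma reach_prob_liminf (x eta : R) : x < t -> 0 < eta ->
  (forall m, t * sigma m - 1 <= H (N m) - S m) ->
  \forall m \near \oo, Phi x - eta <= reach_prob (N m) m + eta.
Proof.
move=> tx eta0 HN.
have [L L1 [hL _]] := normal_cdf_tails eta0.
pose eps := (t - x) / (`|x| + L + 1).
have xL : 0 < `|x| + L + 1 by have := normr_ge0 x; lra.
have eps0 : 0 < eps by rewrite divr_gt0// subr_gt0.
have near_s := near_scale (`|x| + L + 2) eps0.
near=> m.
have m0 : (0 < m)%N by near: m; exact: nbhs_infty_gt.
have sx : `|x| + L + 2 <= eps * sigma m by near: m; exact: near_s.
have serr : total_err r (eps * sigma m) m <= eta.
  by near: m; exact: near_total_err.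
set s := eps * sigma m in sx serr.
have x0 := normr_ge0 x.
have s0 : 0 <= s by lra.
have sig0 : 0 < sigma m by rewrite -(pmulr_rgt0 _ eps0) -/s; lra.
have w0 : 0 < Num.sqrt (s ^+ 2 + V m).
  by have /andP[h _] := start_scale_bounds m s0; lra.
have := @chain_clt_lower R r r_gt0 r_le s (x * Num.sqrt (s ^+ 2 + V m)) eta m (N m) _ m0.
rewrite mulfK ?gt_eqF// => h; apply: (@le_trans _ _ (Phi x - total_err r s m)).
  by rewrite lerD2l lerN2.
apply: h; first lra.
move=> k km; apply: le_trans hL; rewrite /gauss_value.
apply: normal_cdf_nondecreasing.
have dV : V k <= V m by apply: inv_sqr_sum_nondecreasing; exact: ltnW.
have dS := le_inv_sum_diff (ltnW km).
have s2 : 0 < s ^+ 2 by rewrite exprn_gt0//; lra.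
set w := Num.sqrt (s ^+ 2 + V m - V k).
have w1 : 0 < w by rewrite sqrtr_gt0; lra.
rewrite ler_pdivrMr//.
have : `|x * Num.sqrt (s ^+ 2 + V m) - x * sigma m| <= `|x| * (s + 1).
  exact: start_shift.
rewrite ler_norml => /andP[_ h1].
have sE : (t - x) * sigma m = s * (`|x| + L + 1).
  by rewrite /s /eps; field; rewrite gt_eqF.
(* After squaring, the difference is [L * d * (2 * s - L) + d ^+ 2] with [d] the remaining variance;
   it is nonnegative because [s] exceeds [L]. The surplus [d] is then paid for by [S m - S k]. *)
have Lw : L * w <= s * L + (V m - V k).
  have ww : w ^+ 2 = s ^+ 2 + (V m - V k) by rewrite sqr_sqrtr; lra.
  have r0 : 0 <= s * L + (V m - V k) by rewrite addr_ge0 ?subr_ge0// mulr_ge0//; lra.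
  rewrite -(@ler_pXn2r _ 2)// ?nnegrE//; last by rewrite mulr_ge0//; lra.
  rewrite exprMn ww; set d := V m - V k in dS ww r0 *.
  have d0 : 0 <= d by rewrite subr_ge0.
  rewrite -subr_ge0 (_ : _ - _ = L * d * (2 * s - L) + d ^+ 2); last by ring.
  by rewrite addr_ge0 ?sqr_ge0// !mulr_ge0//; lra.
have := HN m; rewrite mulNr; rewrite mulrBl in sE; nra.
Unshelve. all: by end_near. Qed.

Lemma reach_prob_cvg_normal :
  (forall m, N m = 0%N \/ H (N m) - S m <= t * sigma m + 2) ->
  (forall m, t * sigma m - 1 <= H (N m) - S m) ->
  reach_prob (N m) m @[m --> \oo] --> Phi t.
Proof.
move=> HN1 HN2; apply/cvgrPdist_le => e e0.
have e3 : 0 < e / 3 by lra.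
have /cvgrPdist_le/(_ _ e3)[/= d d0 hd] := @normal_cdf_continuous R t.
have d2 : 0 < d / 2 by lra.
have := hd (t + d / 2); have := hd (t - d / 2).
rewrite /ball_/= opprB addrCA subrr addr0 opprD addNKr normrN gtr0_norm//.
have dd : d / 2 < d by lra.
move=> /(_ dd); rewrite ler_norml => /andP[_ h1].
move=> /(_ dd); rewrite ler_norml => /andP[h2 _].
have tl : t - d / 2 < t by lra.
have tr : t < t + d / 2 by lra.
have := reach_prob_limsup tr e3 HN1.
apply: filterS2 (reach_prob_liminf tl e3 HN2) => m.
(* As the probability is at most 1, the factor [1 - e / 3] of the upper bound costs only another
   [e / 3]. *)
have := reach_prob_le1 R r_le (N m) m; have := reach_prob_ge0 R r_le (N m) m.
rewrite ler_norml; set q := reach_prob _ _; nra.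
Qed.

End chain_limit.

(** * The sums of [1 / r k] and [1 / r k ^ 2], and logarithms *)

Section rank_sums.
Variables (R : realType) (r : nat -> nat).
Hypothesis r0 : r 0%N = 1%N.
Hypothesis r_step : forall m : nat, (r m <= r m.+1 <= (r m).+1)%N.
Local Notation H := (series (@harmonic R)).
Local Notation S := (@inv_sum R r).
Local Notation V := (@inv_sqr_sum R r).

Lemma rank_gt0 k : (0 < r k)%N.
Proof.
elim: k => [|k ih]; first by rewrite r0.
by have /andP[h _] := r_step k; exact: leq_trans ih h.
Qed.

Lemma rank_le k : (r k <= k.+1)%N.
Proof.
elim: k => [|k ih]; first by rewrite r0.
by have /andP[_ h] := r_step k; exact: leq_trans h _.
Qed.

(* The steps where [r] increases contribute [1/2 + ... + 1/r(m)]. *)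
Lemma inv_sum_ysum m : S m + (r m)%:R^-1 = ysum R r m + H (r m).
Proof.
elim: m => [|m ih].
  by rewrite r0 /ysum /inv_sum big_ord0 big_geq// /series/= big_nat1 add0r.
rewrite [S _]big_ord_recr/= -/(S m) ih /ysum (big_nat_recr m.+1)//= /delta/=.
have /andP[h1 h2] := r_step m.
have [rE|rN] := eqVneq (r m.+1) (r m).
  by rewrite rE mul1r addrAC.
have -> : r m.+1 = (r m).+1.
  by apply/eqP; rewrite eqn_leq h2 ltn_neqAle eq_sym rN.
by rewrite series_harmonicS mul0r addr0 addrA.
Qed.

(** [V] runs over [0 <= k < m] and [sigmahat] over [1 <= k <= m], so they differ by the end terms;
    the 1 is the term of [r 0]. *)
Lemma inv_sqr_sum_sigmahat m : V m + ((r m)%:R ^+ 2)^-1 = 1 + sigmahat R r m ^+ 2.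
Proof.
rewrite sqr_sqrtr; last by apply: sumr_ge0 => i _; rewrite invr_ge0 exprn_ge0.
have -> : V m + ((r m)%:R ^+ 2)^-1 = V m.+1 by rewrite [RHS]big_ord_recr.
rewrite [LHS]big_ord_recl r0 expr1n invr1; congr (1 + _).
by rewrite big_add1/= big_mkord.
Qed.

Lemma sigmahat_bounds m : sigmahat R r m ^+ 2 <= V m <= sigmahat R r m ^+ 2 + 1.
Proof.
have := inv_sqr_sum_sigmahat m.
have : 0 <= ((r m)%:R ^+ 2)^-1 :> R by rewrite invr_ge0 exprn_ge0.
have : ((r m)%:R ^+ 2)^-1 <= 1 :> R.
  by rewrite invf_le1 ?exprn_gt0 ?ltr0n ?rank_gt0// exprn_ege1// ler1n rank_gt0.
by move=> ? ? ?; apply/andP; split; lra.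
Qed.

Lemma sigmahat_dvg :
  (\sum_(0 <= m <oo) (((r m)%:R ^+ 2)^-1 : R)%:E = +oo)%E ->
  sigmahat R r m @[m --> \oo] --> +oo.
Proof.
move=> r_div.
have Vdvg : V m @[m --> \oo] --> +oo.
  apply: nondecreasing_dvgn_lt.
    by move=> a b; exact: inv_sqr_sum_nondecreasing.
  move=> cvgV; move: r_div; rewrite (_ : (fun _ => _) = EFin \o V); last first.
    by apply/funext => n; rewrite /= sumEFin big_mkord.
  by rewrite EFin_lim.
apply/cvgryPge => A; move/cvgryPge : Vdvg => /(_ (A ^+ 2 + 1)).
apply: filterS => m VA; have /andP[_ h] := sigmahat_bounds m.
apply: le_trans (ler_norm A) _.
rewrite -(@ler_pXn2r _ 2)// ?nnegrE ?sqrtr_ge0// -normrX ger0_norm ?sqr_ge0//.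
lra.
Qed.

Lemma ln_succ_bounds (n : nat) :
  (n.+2%:R^-1 : R) <= ln (n.+2%:R : R) - ln (n.+1%:R : R) <= n.+1%:R^-1.
Proof.
have n1 : 0 < n.+1%:R :> R by rewrite ltr0n.
have n2 : 0 < n.+2%:R :> R by rewrite ltr0n.
have n12 : n.+2%:R = n.+1%:R + 1 :> R by rewrite natr1.
apply/andP; split.
  rewrite -[leRHS]opprB lerNr -ln_div ?posrE//.
  rewrite (_ : _ / _ = 1 + - n.+2%:R^-1); last by field; lra.
  apply: le_ln1Dx; rewrite ltrN2 invf_lt1//; lra.
rewrite -ln_div ?posrE// (_ : _ / _ = 1 + n.+1%:R^-1).
  by apply: le_ln1Dx; apply: (@lt_trans _ _ 0); rewrite ?invr_gt0//; lra.
by field; lra.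
Qed.

Lemma harmonic_ge_ln n : ln n.+1%:R <= H n.
Proof.
elim: n => [|n ih]; first by rewrite ln1 /series/= big_nil.
rewrite series_harmonicS; have /andP[_ h] := ln_succ_bounds n.
by rewrite -[leLHS](subrK (ln n.+1%:R)) addrC lerD.
Qed.

Lemma harmonic_le_ln n : H n.+1 <= 1 + ln n.+1%:R.
Proof.
elim: n => [|n ih]; first by rewrite ln1 /series/= big_nat1 /= invr1; lra.
rewrite series_harmonicS; have /andP[h _] := ln_succ_bounds n.
by rewrite -[ln n.+2%:R](subrK (ln n.+1%:R)) [_ - _ + _]addrC addrA lerD.
Qed.

(** By [inv_sum_ysum] the difference is the harmonic sum up to [r m - 1] minus [ln (r m)], a number
    between 0 and 1. Being bounded, it is negligible against [sigmahat m]. *)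
Lemma inv_sum_center m : `|S m - (ysum R r m + ln (r m)%:R)| <= 1.
Proof.
have := inv_sum_ysum m; have := rank_gt0 m.
case: (r m) => // k _; have := harmonic_le_ln k; have := harmonic_ge_ln k.
rewrite series_harmonicS.
have : 0 < k.+1%:R^-1 :> R by rewrite invr_gt0.
set u := k.+1%:R^-1; set l := ln k.+1%:R => u0 h1 h2 h3.
by rewrite ler_norml; apply/andP; split; lra.
Qed.

End rank_sums.

(** * The hiring process *)

Section hiring_process.
Variables (R : realType) (r : nat -> nat).
Implicit Types (x : nat -> R) (s : seq R) (y : R).

(** For [y] distinct from the entries of [s], this is one less than the rank of [y], counted from
    the top, once it joins [s]. *)
Definition count_ge (y : R) (s : seq R) : nat := count (fun z => y <= z) s.

Lemma count_ge_anti y y' s : y <= y' -> (count_ge y' s <= count_ge y s)%N.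
Proof. by move=> yy'; apply: sub_count => z /=; exact: le_trans. Qed.

Lemma sorted_nth_ge y s k : sorted >=%R s -> (k < size s)%N ->
  (y <= nth 0 s k) = (k < count_ge y s)%N.
Proof.
elim: s k => // a s ih k /= as_; rewrite /count_ge /= -/(count_ge y s) => ks.
have [ya|ay] := leP y a.
  by case: k ks => [|k] ks /=; [rewrite ya|rewrite ih// (path_sorted as_)].
have s_le z : z \in s -> z < y.
  by move/(allP (order_path_min ge_trans as_)) => /= /le_lt_trans; exact.
have -> : count_ge y s = 0%N.
  apply/eqP; rewrite -leqn0 leqNgt -has_count; apply/hasPn => z /s_le.
  by rewrite ltNge.
rewrite addn0 ltn0; apply/negbTE; rewrite -ltNge.
by case: k ks => [|k] ks //=; rewrite s_le// mem_nth.
Qed.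

Lemma threshold_lt s y : (forall m, (0 < r m)%N) ->
  (threshold r s < y) =
  if (r (size s) <= size s)%N then (count_ge y s < r (size s))%N else 0 < y.
Proof.
move=> r_gt0; rewrite /threshold; case: ifP => // rs.
rewrite ltNge sorted_nth_ge ?size_sort ?prednK//; last first.
  by apply: sort_sorted; exact: ge_total.
by rewrite -ltnNge /count_ge (permP (permEl (perm_sort _ _))).
Qed.

Lemma size_accepted_step x n : (size (accepted r x n) <= size (accepted r x n.+1)
  <= (size (accepted r x n)).+1)%N.
Proof. by rewrite /=; case: ifP => _; rewrite ?size_rcons ?leqnn ?leqnSn. Qed.

Lemma size_accepted_homo x :
  {homo (fun n => size (accepted r x n)) : a b / (a <= b)%N}.
Proof.
apply: homo_leq => // [a b c|n]; first exact: leq_trans.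
by have /andP[] := size_accepted_step x n.
Qed.

(** The strict lower bound excludes the default value 0. Otherwise the two events agree because the
    number of accepted candidates grows by at most one at a time and so cannot skip [m]. *)
Lemma accepted_index_le x m n : (0 < m)%N ->
  (0 < accepted_index r x m <= n)%N = (m <= size (accepted r x n))%N.
Proof.
move=> m0; apply/idP/idP; rewrite /accepted_index.
  case: xgetP => [N _ [_ <-] /andP[_ Nn]|//]; exact: size_accepted_homo.
move=> mn.
have ex : exists j, (m <= size (accepted r x j))%N by exists n.
case: xgetP => [N _ [N1 N2]|none].
  have N0 : (0 < N)%N by case: N N1 {N2} => //; rewrite ltnn.
  rewrite N0 leqNgt; apply/negP => nN.
  have : (size (accepted r x n) <= size (accepted r x N.-1))%N.
    by apply: size_accepted_homo; rewrite -ltnS prednK.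
  by move/(leq_trans mn); rewrite -N2 leqNgt N1.
have [j mj jmin] := ex_minnP ex.
case: j mj jmin => [|j] mj jmin; first by move: mj; rewrite leqNgt m0.
exfalso; apply: (none j.+1); have jm : (size (accepted r x j) < m)%N.
  by rewrite ltnNge; apply/negP => /jmin; rewrite ltnn.
have /andP[_ h] := size_accepted_step x j.
have E : size (accepted r x j.+1) = m.
  by apply/eqP; rewrite eqn_leq mj andbT (leq_trans h).
by split; rewrite ?E.
Qed.

Section positive_values.
Hypothesis r_gt0 : forall m, (0 < r m)%N.
Hypothesis r_step : forall m : nat, (r m <= r m.+1 <= (r m).+1)%N.
Variable x : nat -> R.
Hypothesis x_gt0 : forall n, 0 < x n.

(** If [r] exceeds the size of [s], the threshold 0 is below every positive value and the count is
    trivially small, so one rank condition covers both cases. *)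
Lemma threshold_lt_pos n s :
  (threshold r s < x n) = (count_ge (x n) s < r (size s))%N.
Proof.
rewrite threshold_lt//; case: (leqP _ (size s)) => // sr.
by rewrite x_gt0; apply/esym; apply: leq_ltn_trans sr; exact: count_size.
Qed.

(* Rejected values never compete with the [r]-th largest accepted value. *)
Lemma count_ge_accepted n y :
  let s := accepted r x n in
  (count_ge y s <= count_ge y (mkseq x n))%N /\
  ((count_ge y s < r (size s))%N -> count_ge y (mkseq x n) = count_ge y s).
Proof.
elim: n y => [|n ih] y //.
rewrite mkseqS /= threshold_lt_pos /count_ge -!cats1 count_cat /= addn0 -!/(count_ge _ _).
set s := accepted r x n in ih *; case: (ltnP (count_ge (x n) s) _) => xs.
  rewrite /count_ge count_cat size_cat /= addn0 addn1 -!/(count_ge _ _).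
  have [le1 eq1] := ih y; split; first by rewrite leq_add2r.
  move=> h; congr (_ + _)%N; apply: eq1.
  have /andP[_ rS] := r_step (size s).
  (* If [y <= x n], the count gains one and [r] gains at most one. Otherwise [y] has no more
     competitors than [x n], which was accepted. *)
  case: (leP y (x n)) h => [yx|xy] h.
    by rewrite addn1 in h; rewrite -ltnS (leq_trans h).
  by apply: leq_ltn_trans xs; apply: count_ge_anti; exact: ltW.
have [le1 eq1] := ih y; split; first by rewrite (leq_trans le1)// leq_addr.
(* A [y] below the rejected [x n] would have at least as many competitors as [x n], against [h]. *)
move=> h; rewrite eq1//; case: (leP y (x n)) => [yx|_]; last by rewrite addn0.
by have := leq_trans xs (count_ge_anti s yx); rewrite leqNgt h.
Qed.

Lemma size_acceptedS n : size (accepted r x n.+1) =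
  (size (accepted r x n) +
   (count_ge (x n) (mkseq x n) < r (size (accepted r x n))))%N.
Proof.
rewrite /= threshold_lt_pos; have [le1 eq1] := count_ge_accepted n (x n).
have -> : (count_ge (x n) (mkseq x n) < r (size (accepted r x n)))%N =
          (count_ge (x n) (accepted r x n) < r (size (accepted r x n)))%N.
  by apply/idP/idP => [/(leq_ltn_trans le1)//|h]; rewrite eq1.
by case: ifP; rewrite ?size_rcons ?addn1 ?addn0.
Qed.

End positive_values.

End hiring_process.

(** * Measurability of the hiring process *)

Section discrete_measurability.
Context d (T : measurableType d) (R : realType).

(** Phrased by level sets, so that maps into numbers or sequences of booleans need no sigma-algebra
    on their target; for a countable target every preimage is then measurable. *)
Definition discrete_measurable (S : Type) (f : T -> S) : Prop :=
  forall s, measurable [set w | f w = s].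

Lemma discrete_measurable_set (S : countType) (f : T -> S) (p : set S) :
  discrete_measurable f -> measurable [set w | p (f w)].
Proof.
move=> mf; have -> : [set w | p (f w)] = \bigcup_(s in p) [set w | f w = s].
  by apply/seteqP; split => [w pf|w [s ps] /= ->//]; exists (f w).
rewrite bigcup_mkcond; apply: countable_bigcupT_measurable => //.
by move=> s; case: ifP.
Qed.

Lemma discrete_measurable_comp (S : countType) (S' : Type) (g : S -> S')
    (f : T -> S) : discrete_measurable f -> discrete_measurable (g \o f).
Proof.
by move=> mf s; exact: (discrete_measurable_set [set u | g u = s] mf).
Qed.

Lemma discrete_measurable_pair (S S' : Type) (f : T -> S) (g : T -> S') :
  discrete_measurable f -> discrete_measurable g ->
  discrete_measurable (fun w => (f w, g w)).
Proof.
move=> mf mg [s s']; have -> : [set w | (f w, g w) = (s, s')] =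
    [set w | f w = s] `&` [set w | g w = s'].
  by apply/seteqP; split => w /= [-> ->].
exact: measurableI.
Qed.

Lemma discrete_measurable_map (S : countType) (I : Type) (l : seq I)
    (f : I -> T -> S) : (forall i, discrete_measurable (f i)) ->
  discrete_measurable (fun w => [seq f i w | i <- l]).
Proof.
move=> mf; elim: l => [|i l ih] /=.
  move=> s; have [->|s0] := eqVneq s [::].
    by rewrite (_ : [set _ | _] = setT)//; apply/seteqP.
  rewrite (_ : [set _ | _] = set0)//; apply/seteqP; split => // w /= e.
  by rewrite -e in s0.
exact: (discrete_measurable_comp (fun u => u.1 :: u.2)
  (discrete_measurable_pair (mf i) ih)).
Qed.

Lemma discrete_measurable_bool (b : T -> bool) : measurable [set w | b w] ->
  discrete_measurable b.
Proof.
move=> mb [].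
  by rewrite (_ : [set _ | _] = [set w | b w]).
rewrite (_ : [set _ | _] = ~` [set w | b w]); first exact: measurableC.
by apply/seteqP; split => w /=; [move=> ->|move=> /negP/negbTE].
Qed.

Lemma discrete_measurable_ltr (f g : T -> R) : measurable_fun setT f ->
  measurable_fun setT g -> discrete_measurable (fun w => f w < g w).
Proof.
move=> mf mg; apply: discrete_measurable_bool.
have := measurable_fun_ltr mf mg measurableT (Logic.I : measurable [set true]).
by rewrite setTI; congr (measurable _); apply/seteqP; split.
Qed.

Lemma discrete_measurable_ler (f g : T -> R) : measurable_fun setT f ->
  measurable_fun setT g -> discrete_measurable (fun w => f w <= g w).
Proof.
move=> mf mg; apply: discrete_measurable_bool.
have := measurable_fun_ler mf mg measurableT (Logic.I : measurable [set true]).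
by rewrite setTI; congr (measurable _); apply/seteqP; split.
Qed.

Lemma measurable_eqr (f g : T -> R) : measurable_fun setT f ->
  measurable_fun setT g -> measurable [set w | f w = g w].
Proof.
move=> mf mg; have := discrete_measurable_comp (fun u : bool * bool => u.1 && u.2)
  (discrete_measurable_pair (discrete_measurable_ler mf mg)
    (discrete_measurable_ler mg mf)) true.
congr (measurable _); apply/seteqP; split => w /=.
  by move=> h; apply/eqP; rewrite eq_le h.
by move=> ->; rewrite lexx.
Qed.

End discrete_measurability.

Section hiring_measurability.
Context (R : realType) d (T : measurableType d) (X : nat -> T -> R).
Variable r : nat -> nat.
Hypothesis r_gt0 : forall m, (0 < r m)%N.
Hypothesis mX : forall n, measurable_fun setT (X n).

(** Unlike the list of accepted values, the mask lives in a countable type and is a function of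
    finitely many comparisons between values. *)
Fixpoint accepted_mask (x : nat -> R) (n : nat) : bitseq :=
  if n is k.+1 then
    let b := accepted_mask x k in
    rcons b (threshold r (mask b (mkseq x k)) < x k)
  else [::].

Lemma size_accepted_mask x n : size (accepted_mask x n) = n.
Proof. by elim: n => //= n ih; rewrite size_rcons ih. Qed.

Lemma acceptedE x n : accepted r x n = mask (accepted_mask x n) (mkseq x n).
Proof.
elim: n => // n ih; rewrite mkseqS /= -ih.
rewrite mask_rcons ?size_mkseq ?size_accepted_mask// -ih.
by case: ifP => _ /=; rewrite ?cats1 ?cats0.
Qed.

Lemma discrete_measurable_accepted_mask n :
  discrete_measurable (fun w => accepted_mask (X ^~ w) n).
Proof.
elim: n => [|n ih].
  move=> s; have [->|s0] := eqVneq s [::].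
    by rewrite (_ : [set _ | _] = setT)//; apply/seteqP.
  rewrite (_ : [set _ | _] = set0)//; apply/seteqP; split => // w /= e.
  by rewrite -e in s0.
(* [u.1] is the mask so far, [u.2.1] compares the new value with the earlier ones, and [u.2.2] is
   its comparison with the threshold 0. *)
pose G (u : bitseq * (bitseq * bool)) :=
  rcons u.1 (if (r (count id u.1) <= count id u.1)%N
             then (count id (mask u.1 u.2.1) < r (count id u.1))%N else u.2.2).
have -> : (fun w => accepted_mask (X ^~ w) n.+1) = G \o (fun w =>
    (accepted_mask (X ^~ w) n,
     ([seq X n w <= X j w | j <- iota 0 n], 0 < X n w))).
  apply/funext => w /=; rewrite /G /= threshold_lt//.
  rewrite size_mask ?size_mkseq ?size_accepted_mask//.
  have -> : [seq X n w <= X j w | j <- iota 0 n] =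
      [seq X n w <= z | z <- mkseq (X ^~ w) n] by rewrite /mkseq -map_comp.
  by rewrite -map_mask count_map.
apply: discrete_measurable_comp; apply: discrete_measurable_pair => //.
apply: discrete_measurable_pair; last exact: discrete_measurable_ltr.
apply: discrete_measurable_map => j; exact: discrete_measurable_ler.
Qed.

Lemma discrete_measurable_size_accepted n :
  discrete_measurable (fun w => size (accepted r (X ^~ w) n)).
Proof.
have -> : (fun w => size (accepted r (X ^~ w) n)) =
    count id \o (fun w => accepted_mask (X ^~ w) n).
  apply/funext => w /=; rewrite acceptedE size_mask//.
  by rewrite size_mkseq size_accepted_mask.
apply: discrete_measurable_comp; exact: discrete_measurable_accepted_mask.
Qed.

Lemma discrete_measurable_count_ge n :
  discrete_measurable (fun w => count_ge (X n w) (mkseq (X ^~ w) n)).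
Proof.
have -> : (fun w => count_ge (X n w) (mkseq (X ^~ w) n)) =
    count id \o (fun w => [seq X n w <= X j w | j <- iota 0 n]).
  by apply/funext => w /=; rewrite /count_ge /mkseq !count_map.
apply: discrete_measurable_comp; apply: discrete_measurable_map => j.
exact: discrete_measurable_ler.
Qed.

Lemma discrete_measurable_accepted_index m :
  discrete_measurable (fun w => accepted_index r (X ^~ w) m).
Proof.
have mM n : measurable [set w | (0 < accepted_index r (X ^~ w) m <= n)%N].
  case: m => [|m].
    rewrite (_ : [set _ | _] = set0)//; apply/seteqP; split => // w /=.
    rewrite /accepted_index; case: xgetP => // N _ [N1 N2].
    by rewrite N2 ltn0 in N1.
  rewrite (_ : [set _ | _] = [set w | (m < size (accepted r (X ^~ w) n))%N]).
    exact: (discrete_measurable_set [set k : nat | (m < k)%N]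
      (discrete_measurable_size_accepted n)).
  by apply/seteqP; split => w /=; rewrite accepted_index_le.
case=> [|j].
  rewrite (_ : [set _ | _] = ~` \bigcup_n
    [set w | (0 < accepted_index r (X ^~ w) m <= n)%N]).
    by apply: measurableC; exact: bigcupT_measurable.
  apply/seteqP; split => w /=.
    by move=> e [n _] /=; rewrite e.
  move=> h; apply/eqP; rewrite -leqn0 leqNgt; apply/negP => h0; apply: h.
  by exists (accepted_index r (X ^~ w) m) => //=; rewrite h0 leqnn.
rewrite (_ : [set _ | _] = [set w | (0 < accepted_index r (X ^~ w) m <= j.+1)%N]
  `\` [set w | (0 < accepted_index r (X ^~ w) m <= j)%N]).
  exact: measurableD.
apply/seteqP; split => w /=.
  by move=> ->; rewrite ltnn leqnn.
by move=> [/andP[h0 h1] /negP]; rewrite h0 /= -ltnNge => h2; apply/eqP; rewrite eqn_leq h1.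
Qed.

End hiring_measurability.

(** * Relative orders of the candidates *)

Section insertion.
Variable R : realType.
Implicit Types (s : seq R) (y : R).

Let gtr_trans : transitive (>%R : rel R).
Proof. by move=> b a c ab bc; exact: lt_trans bc ab. Qed.

Lemma sorted_gt_insert y s : sorted >%R s -> y \notin s ->
  sorted >%R (take (count_ge y s) s ++ y :: drop (count_ge y s) s).
Proof.
rewrite !(sorted_pairwise gtr_trans); elim: s => // a s ih.
rewrite inE negb_or => /= /andP[as_ ss] /andP[ya ys].
rewrite /count_ge /= -/(count_ge y s); have [yla|ay] := leP y a.
  rewrite add1n /= ih// andbT all_cat /= lt_neqAle ya yla/=.
  by rewrite -all_cat cat_take_drop.
have -> : count_ge y s = 0%N.
  apply/eqP; rewrite -leqn0 leqNgt -has_count; apply/hasPn => z /(allP as_) /=.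
  by rewrite -ltNge => /lt_trans; apply.
rewrite /= ay as_ ss !andbT; apply: sub_all as_ => z /=.
by move=> /lt_trans; apply.
Qed.

Lemma sorted_gt_insert_inv y s l : (l <= size s)%N ->
  sorted >%R (take l s ++ y :: drop l s) -> sorted >%R s /\ count_ge y s = l.
Proof.
move=> ls; rewrite !(sorted_pairwise gtr_trans) pairwise_cat allrel_consr /=.
move=> /and3P[/andP[ty td] pt /andP[dy pd]]; split.
  by rewrite -(cat_take_drop l s) pairwise_cat td pt.
rewrite -{1}(cat_take_drop l s) /count_ge count_cat.
have -> : count (fun z => y <= z) (drop l s) = 0%N.
  apply/eqP; rewrite -leqn0 leqNgt -has_count; apply/hasPn => z /(allP dy) /=.
  by rewrite -ltNge.
rewrite addn0 -[RHS](size_takel ls); apply/eqP; rewrite -all_count.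
by apply: sub_all ty => z /ltW.
Qed.

End insertion.

Section value_order.
Variables (R : realType) (x : nat -> R).
Implicit Type L : seq nat.

Definition decreasing_along L : bool := sorted >%R [seq x i | i <- L].

(** If [L] ranks the first [n] candidates by decreasing value, this is the ranking in which
    candidate [n] has exactly [l] of them above. *)
Definition insert_at (n l : nat) L : seq nat := take l L ++ n :: drop l L.

Lemma count_ge_perm n L : perm_eq L (iota 0 n) ->
  count_ge (x n) (mkseq x n) = count_ge (x n) [seq x i | i <- L].
Proof. by move=> Ln; apply/permP; rewrite perm_sym; exact: perm_map. Qed.

Lemma decreasing_along_insert n L : injective x -> perm_eq L (iota 0 n) ->
  decreasing_along L ->
  decreasing_along (insert_at n (count_ge (x n) (mkseq x n)) L).
Proof.
move=> xI Ln dL; rewrite /decreasing_along /insert_at map_cat /= map_take map_drop.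
rewrite (count_ge_perm Ln); apply: sorted_gt_insert => //.
by rewrite mem_map// (perm_mem Ln) mem_iota ltnn.
Qed.

Lemma decreasing_along_insert_inv n l L : perm_eq L (iota 0 n) -> (l <= n)%N ->
  decreasing_along (insert_at n l L) ->
  decreasing_along L /\ count_ge (x n) (mkseq x n) = l.
Proof.
move=> Ln ln; rewrite /decreasing_along /insert_at map_cat /= map_take map_drop.
rewrite (count_ge_perm Ln); apply: sorted_gt_insert_inv.
by rewrite size_map (perm_size Ln) size_iota.
Qed.

Lemma decreasing_along_uniq L L' : perm_eq L L' -> decreasing_along L ->
  decreasing_along L' -> L = L'.
Proof.
rewrite /decreasing_along !sorted_map => LL' d1 d2.
apply: (irr_sorted_eq _ _ d1 d2).
- by move=> b a c /= ab bc; exact: lt_trans bc ab.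
- by move=> a /=; rewrite ltxx.
- exact: perm_mem.
Qed.

Lemma decreasing_along_exists s : injective x -> uniq s ->
  exists2 L, perm_eq L s & decreasing_along L.
Proof.
move=> xI us; exists (rev (sort (relpre x <=%R) s)).
  by rewrite perm_rev perm_sort.
rewrite /decreasing_along map_rev rev_sorted.
have : sorted <%R [seq x i | i <- sort (relpre x <=%R) s].
  rewrite lt_sorted_uniq_le map_inj_uniq// sort_uniq us /=.
  by rewrite sorted_map; apply: sort_sorted => a b /=; exact: le_total.
by [].
Qed.

Lemma decreasing_along_index L i j : decreasing_along L -> i \in L -> j \in L ->
  (x j <= x i) = (index i L <= index j L)%N.
Proof.
rewrite /decreasing_along sorted_map => dL iL jL.
have tr : transitive (relpre x >%R).
  by move=> b a c /= ab bc; exact: lt_trans bc ab.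
have [ij|ji|ij] := ltngtP (index i L) (index j L).
- by apply: ltW; exact: (sorted_ltn_index tr dL i j iL jL ij).
- apply/negbTE; rewrite -ltNge; exact: (sorted_ltn_index tr dL j i jL iL ji).
- have -> : i = j by rewrite -(nth_index 0%N iL) ij nth_index.
  by rewrite lexx.
Qed.

End value_order.

(** The acceptance count recomputed from the relative order alone. It makes the past a function of
    the order, so that independence of a new rank from the order is all that is needed. *)
Fixpoint order_accepted (r : nat -> nat) (L : seq nat) (n : nat) : nat :=
  if n is k.+1 then
    let m := order_accepted r L k in
    (m + (count (fun i => index i L <= index k L) (iota 0 k) < r m))%N
  else 0%N.

Lemma size_accepted_order (R : realType) (r : nat -> nat) (x : nat -> R) L n j :
  (forall m, (0 < r m)%N) -> (forall m, (r m <= r m.+1 <= (r m).+1)%N) ->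
  (forall i, 0 < x i) -> perm_eq L (iota 0 n) -> decreasing_along x L ->
  (j <= n)%N -> size (accepted r x j) = order_accepted r L j.
Proof.
move=> r_gt0 r_step x_gt0 Ln dL; elim: j => // j ih jn.
rewrite size_acceptedS// ih ?(ltnW jn)//=; congr (_ + (_ < _))%N.
have inL i : (i <= j)%N -> i \in L.
  by move=> ij; rewrite (perm_mem Ln) mem_iota/= add0n (leq_ltn_trans ij).
rewrite /count_ge /mkseq count_map; apply: eq_in_count => i.
rewrite mem_iota add0n /= => ij.
by apply: decreasing_along_index => //; apply: inL => //; exact: ltnW.
Qed.

(** * Uniformity of the ranks *)

Section exchangeability.
Context (R : realType) d (T : measurableType d) (P : probability T R).
Variables (X : nat -> {RV P >-> R}) (mu : set R -> \bar R).
Hypothesis X_indep : mutually_independent X.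
Hypothesis X_law : forall n, has_law (X n) mu.
Implicit Types (L : seq nat).

Definition select L (w : T) : nat -> R := fun i => X (nth 0%N L i) w.

(** A pi-system that sees only the first [n] coordinates: it expresses the joint law of [n] values
    while keeping sequences indexed by [nat]. *)
Definition rectangle (n : nat) : set (set (nat -> R)) :=
  [set B | exists2 A : nat -> set R, (forall i, measurable (A i)) &
     B = [set x | forall i, (i < n)%N -> A i (x i)]].

Lemma prob_rectangle L (A : nat -> set R) : uniq L ->
  (forall i, measurable (A i)) ->
  P [set w | forall i, (i < size L)%N -> A i (select L w i)] =
  (\prod_(i < size L) mu (A i))%E.
Proof.
move=> uL mA.
pose A' j := A (index j L).
have := X_indep [fset j in L]%fset (fun j => mA (index j L)).
rewrite (_ : \bigcap_(j in _) _ =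
  [set w | forall i, (i < size L)%N -> A i (select L w i)]); last first.
  apply/seteqP; split => w /= h.
    move=> i iL; have := h (nth 0%N L i); rewrite /= index_uniq//; apply.
    by rewrite in_fset/= mem_nth.
  move=> j /=; rewrite in_fset => jL; have := h (index j L).
  by rewrite index_mem /select nth_index// => /(_ jL).
move=> ->; rewrite (perm_big L); last first.
  by apply: uniq_perm => [||j]; rewrite ?fset_uniq ?in_fset.
rewrite (big_nth 0%N) big_mkord; apply: eq_bigr => i _.
by rewrite index_uniq//; exact: (X_law _ (mA i)).
Qed.

Lemma measurable_rectangle L B : rectangle (size L) B ->
  measurable [set w | B (select L w)].
Proof.
move=> [A mA ->].
rewrite (_ : [set _ | _] = \bigcap_(i in [set k | (k < size L)%N])
  (X (nth 0%N L i) @^-1` A i)).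
  by apply: bigcap_measurableType => i _; rewrite -[X in measurable X]setTI;
    exact: measurable_funP.
by apply/seteqP; split.
Qed.

(** Dynkin's argument: on rectangles both sides are the same product of marginals, and the sets of
    agreement form a Dynkin system. Measurability is carried along because closure under complements
    and disjoint unions uses it. *)
Lemma exchangeable L L' B : uniq L -> uniq L' -> size L = size L' ->
  <<s rectangle (size L) >> B ->
  measurable (select L @^-1` B) /\
  P (select L @^-1` B) = P (select L' @^-1` B).
Proof.
move=> uL uL' LL'.
pose D := [set B | [/\ measurable (select L @^-1` B),
   measurable (select L' @^-1` B) &
   P (select L @^-1` B) = P (select L' @^-1` B)]].
suff : <<s rectangle (size L) >> `<=` D by move=> h /h[].
have IR : setI_closed (rectangle (size L)).
  move=> B1 B2 [A1 mA1 ->] [A2 mA2 ->].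
  exists (fun i => A1 i `&` A2 i); first by move=> i; exact: measurableI.
  apply/seteqP; split => x /=.
    by move=> [h1 h2] i iL; split; [exact: h1|exact: h2].
  by move=> h; split => i iL; have [] := h i iL.
rewrite -(setI_closed_g_dynkin_g_sigma_algebra IR).
apply: smallest_sub; last first.
  move=> B' RB; split; first exact: measurable_rectangle.
    by apply: measurable_rectangle; rewrite -LL'.
  by move: RB => [A mA ->]; rewrite prob_rectangle// LL' prob_rectangle.
split.
- by split; rewrite ?preimage_setT.
- move=> B' [m1 m2 e]; split.
  + exact: (measurableC m1).
  + exact: (measurableC m2).
  + by transitivity (1 - P (select L @^-1` B'))%E;
      [exact: probability_setC|rewrite e; exact/esym/probability_setC].
- move=> F tF mF.
  have tr M : trivIset setT (fun k => select M @^-1` F k).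
    by move=> i j _ _ [w [Fi Fj]]; apply: tF => //; exists (select M w).
  have UE M : select M @^-1` (\bigcup_k F k) = \bigcup_k (select M @^-1` F k).
    exact: preimage_bigcup.
  have mU M : (forall k, measurable (select M @^-1` F k)) ->
      measurable (select M @^-1` (\bigcup_k F k)).
    by rewrite UE; exact: bigcupT_measurable.
  split.
  + by apply: mU => k; have [] := mF k.
  + by apply: mU => k; have [] := mF k.
  + rewrite !UE !measure_semi_bigcup//.
    * by apply: eq_eseriesr => k _; have [] := mF k.
    * by move=> k; have [] := mF k.
    * by apply: bigcupT_measurable => k; have [] := mF k.
    * by move=> k; have [] := mF k.
    * by apply: bigcupT_measurable => k; have [] := mF k.
Qed.

Definition decreasing_upto n : set (nat -> R) :=
  [set x | forall i, (i.+1 < n)%N -> x i.+1 < x i].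

Lemma decreasing_upto_sigma n : <<s rectangle n >> (decreasing_upto n).
Proof.
pose S := g_sigma_algebraType (rectangle n).
have mproj i : (i < n)%N -> measurable_fun setT (fun x : S => (x : nat -> R) i).
  move=> ni _ A mA; rewrite setTI; apply: sub_sigma_algebra.
  exists (fun j => if j == i then A else setT).
    by move=> j; case: ifP.
  apply/seteqP; split => x /=.
    by move=> Ax j _; case: eqP => // ->.
  by move=> /(_ i ni); rewrite eqxx.
suff : measurable (decreasing_upto n : set S) by [].
rewrite (_ : decreasing_upto n = \bigcap_(i in [set k | (k.+1 < n)%N])
   [set x | x i.+1 < x i]); last by apply/seteqP; split.
apply: bigcap_measurableType => i /= ni.
have := discrete_measurable_ltr (mproj _ ni) (mproj _ (ltnW ni)) true.
by [].
Qed.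

Lemma decreasing_along_select L w :
  decreasing_along (X ^~ w) L <-> decreasing_upto (size L) (select L w).
Proof.
rewrite /decreasing_along sorted_map; split.
  move=> /(sortedP 0%N) h i iL; exact: h.
by move=> h; apply/(sortedP 0%N) => i iL; exact: h.
Qed.

Lemma measurable_decreasing_along L : uniq L ->
  measurable [set w | decreasing_along (X ^~ w) L].
Proof.
move=> uL; have [+ _] := exchangeable uL uL erefl (@decreasing_upto_sigma (size L)).
by congr (measurable _); apply/seteqP; split => w /decreasing_along_select.
Qed.

Lemma prob_decreasing_along L L' : uniq L -> uniq L' -> size L = size L' ->
  P [set w | decreasing_along (X ^~ w) L] =
  P [set w | decreasing_along (X ^~ w) L'].
Proof.
move=> uL uL' LL'.
have [_] := exchangeable uL uL' LL' (@decreasing_upto_sigma (size L)).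
have E M : [set w | decreasing_along (X ^~ w) M] =
    [set w | decreasing_upto (size M) (select M w)].
  by apply/seteqP; split => w /decreasing_along_select.
by rewrite !E -LL'.
Qed.

End exchangeability.

(** * Ties and nonpositive values have probability zero *)

Section null_sets.
Context (R : realType) d (T : measurableType d) (P : probability T R).

Lemma le_prob_off_null (N A B : set T) : P.-negligible N -> measurable A ->
  measurable B -> (forall w, ~ N w -> A w -> B w) -> (P A <= P B)%E.
Proof.
move=> [M [mM M0 NM]] mA mB AB; rewrite -[leRHS]adde0 -M0.
apply: (@le_trans _ _ (P (B `|` M))).
  apply: le_measure; rewrite ?inE//; first exact: measurableU.
  by move=> w Aw; have [Mw|nMw] := pselect (M w); [right|left; apply: AB => // /NM].
exact: measureU2.
Qed.

Lemma eq_prob_off_null (N A B : set T) : P.-negligible N -> measurable A ->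
  measurable B -> (forall w, ~ N w -> A w <-> B w) -> P A = P B.
Proof.
move=> nN mA mB AB; apply/eqP; rewrite eq_le.
by rewrite !(le_prob_off_null nN)// => w /AB[].
Qed.

Variables (X : nat -> {RV P >-> R}) (mu : set R -> \bar R).
Hypothesis X_indep : mutually_independent X.
Hypothesis X_law : forall n, has_law (X n) mu.
Hypothesis mu_atomless : forall y, mu [set y] = 0%E.

(** By uniqueness of the product measure the pair has a product law, and each section of the
    diagonal is a single point, hence null. *)
Lemma prob_tie i j : i != j -> P [set w | X i w = X j w] = 0%E.
Proof.
move=> ij; pose f w := (X i w, X j w).
have mf : measurable_fun setT f by exact: measurable_fun_pair.
pose F : {mfun T >-> (R * R)%type} := HB.pack f (@isMeasurableFun.Build _ _ _ _ f mf).
(* [mu] is only a set function; [m] has the same values on measurable sets and is a measure, as the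
   product construction requires. *)
pose m := distribution P (X 0%N).
have mE A : measurable A -> m A = mu A by exact: X_law.
have mD : measurable [set z : R * R | z.1 = z.2].
  exact: measurable_eqr (@measurable_fst _ _ R R) (@measurable_snd _ _ R R).
have prodE : forall A B, measurable A -> measurable B ->
    distribution P F (A `*` B) = (m A * m B)%E.
  move=> A B mA mB.
  pose C k : set R := if k == 0%N then A else B.
  have mC k : measurable (C k) by rewrite /C; case: ifP.
  have uij : uniq [:: i; j] by rewrite /= inE ij.
  have := prob_rectangle X_indep X_law uij mC.
  rewrite !big_ord_recl big_ord0 mule1 /= !mE// => <-.
  congr (P _); apply/seteqP; split => w /=.
    by move=> [Aw Bw] [|[|//]].
  by move=> h; split; [exact: (h 0%N)|exact: (h 1%N)].
have := product_measure_unique prodE mD.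
rewrite /product_measure1 integral0_eq => [h|z _ /=]; first exact: esym h.
rewrite (_ : xsection _ _ = [set z]); first last.
  by apply/seteqP; split => y; rewrite /xsection /= inE /= => ->.
exact: etrans (mE _ (measurable_set1 z)) (mu_atomless z).
Qed.

Hypothesis mu_le0 : mu [set y | y <= 0] = 0%E.

Definition degenerate : set T :=
  [set w | ~ ((forall i, 0 < X i w) /\ injective (X ^~ w))].

Lemma negligible_degenerate : P.-negligible degenerate.
Proof.
pose N1 := \bigcup_i [set w | X i w <= 0].
pose N2 := \bigcup_i \bigcup_j [set w | i != j /\ X i w = X j w].
have n1 : P.-negligible N1.
  apply: negligible_bigcup => i; apply/negligibleP.
    have m0 : measurable_fun setT (fun _ : T => 0 : R) by exact: measurable_cst.
    exact: (discrete_measurable_ler (measurable_funPT (X i)) m0 true).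
  rewrite -mu_le0 -(X_law i) //.
  by rewrite (_ : [set _ | _] = `]-oo, 0]%classic)//; apply/seteqP; split => y /=;
    rewrite in_itv.
have n2 : P.-negligible N2.
  apply: negligible_bigcup => i; apply: negligible_bigcup => j.
  have [->|ij] := eqVneq i j.
    rewrite (_ : [set _ | _] = set0); first exact: negligible_set0.
    by apply/seteqP; split => // w [/eqP].
  apply: (@negligibleS _ _ _ P [set w | X i w = X j w]) => [w []//|].
  apply/negligibleP; last exact: prob_tie.
  exact: measurable_eqr (measurable_funPT (X i)) (measurable_funPT (X j)).
apply: negligibleS (negligibleU n1 n2) => w deg; apply: contrapT => nN; apply: deg.
split.
  move=> i; rewrite ltNge; apply/negP => Xi; apply: nN; left; exists i => //.
move=> i j Xij; apply/eqP/negPn/negP => ij; apply: nN; right.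
by exists i => //; exists j.
Qed.

End null_sets.

(** * Law of the number of accepted candidates *)

Section accepted_law.
Context (R : realType) d (T : measurableType d) (P : probability T R).

Lemma prob_partition (N : set T) (I : eqType) (s : seq I) (B : I -> set T)
    (A : set T) : P.-negligible N -> uniq s -> measurable A ->
  (forall i, i \in s -> measurable (B i)) ->
  (forall w i j, ~ N w -> i \in s -> j \in s -> B i w -> B j w -> i = j) ->
  (forall w, ~ N w -> A w -> exists2 i, i \in s & B i w) ->
  P A = (\sum_(i <- s) P (A `&` B i))%E.
Proof.
move=> nN; elim: s A => [|i s ih] A us mA mB BB AB.
  rewrite big_nil -(measure0 P); apply: (eq_prob_off_null nN) => // w nw.
  by split => // /(AB _ nw)[].
have mBi : measurable (B i) by apply: mB; rewrite mem_head.
move: us => /= /andP[si us].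
rewrite big_cons (measureDI P mA mBi) [LHS]addeC; congr (_ + _)%E.
apply: etrans (ih (A `\` B i) us (measurableD mA mBi) _ _ _) _.
- by move=> j js; apply: mB; rewrite inE js orbT.
- by move=> w j k nw js ks; apply: (BB w) => //; rewrite inE ?js ?ks orbT.
- move=> w nw [Aw nBi]; have [j] := AB w nw Aw.
  by rewrite inE => /orP[/eqP->//|js Bj]; exists j.
- rewrite !big_seq; apply: eq_bigr => j js.
  have mBj : measurable (B j) by apply: mB; rewrite inE js orbT.
  apply: (eq_prob_off_null nN).
  + by apply: measurableI => //; exact: measurableD.
  + exact: measurableI.
  + move=> w nw; split => [[[Aw _] Bj]//|[Aw Bj]]; split => //; split => // Bi.
    have ij : i = j by apply: (BB w) => //; rewrite inE ?eqxx ?js ?orbT.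
    by move: si; rewrite ij js.
Qed.

Variables (X : nat -> {RV P >-> R}) (mu : set R -> \bar R).
Hypothesis X_indep : mutually_independent X.
Hypothesis X_law : forall n, has_law (X n) mu.
Hypothesis mu_atomless : forall y, mu [set y] = 0%E.
Hypothesis mu_le0 : mu [set y | y <= 0] = 0%E.
Variable r : nat -> nat.
Hypothesis r_gt0 : forall m, (0 < r m)%N.
Hypothesis r_le : forall m, (r m <= m.+1)%N.
Hypothesis r_step : forall m, (r m <= r m.+1 <= (r m).+1)%N.

Let N := degenerate X.
Let nN : P.-negligible N := negligible_degenerate X_indep X_law mu_atomless mu_le0.
Let mX n : measurable_fun setT (X n) := measurable_funPT (X n).
Let E L := [set w | decreasing_along (X ^~ w) L].
Let M n w := size (accepted r (X ^~ w) n).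
Let c n w := count_ge (X n w) (mkseq (X ^~ w) n).

Let nondegenerate w : ~ N w -> (forall i, 0 < X i w) /\ injective (X ^~ w).
Proof. by move=> /contrapT. Qed.

Let mE L n : perm_eq L (iota 0 n) -> measurable (E L).
Proof.
move=> Ln; apply: (measurable_decreasing_along X_indep X_law).
by rewrite (perm_uniq Ln) iota_uniq.
Qed.

Let mc n (p : set nat) : measurable [set w | p (c n w)].
Proof. exact: discrete_measurable_set (discrete_measurable_count_ge mX n). Qed.

Let mM n (p : set nat) : measurable [set w | p (M n w)].
Proof.
exact: discrete_measurable_set (discrete_measurable_size_accepted r_gt0 mX n).
Qed.

Let perm_insert n l L : perm_eq (insert_at n l L) (n :: L).
Proof. by rewrite /insert_at -cat1s perm_catCA /= cat_take_drop. Qed.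

(** Order and new rank together amount to one order of [n + 1] candidates, and all such orders are
    equally likely. As the right side depends on neither [L] nor [l], this contains both the
    uniformity of the rank and its independence of the past. *)
Lemma prob_rank_eq L n l : perm_eq L (iota 0 n) -> (l <= n)%N ->
  P (E L `&` [set w | c n w = l]) = P (E (iota 0 n.+1)).
Proof.
move=> Ln ln; have Ins := perm_insert n l L.
have uL : uniq L by rewrite (perm_uniq Ln) iota_uniq.
have nL : n \notin L by rewrite (perm_mem Ln) mem_iota ltnn.
have uI : uniq (insert_at n l L) by rewrite (perm_uniq Ins) /= nL.
have <- : P (E (insert_at n l L)) = P (E (iota 0 n.+1)).
  apply: (prob_decreasing_along X_indep X_law) => //; first exact: iota_uniq.
  by rewrite (perm_size Ins)/= size_iota (perm_size Ln) size_iota.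
apply: (eq_prob_off_null nN).
- by apply: measurableI; [exact: mE Ln|exact: (mc n [set k | k = l])].
- exact: (measurable_decreasing_along X_indep X_law).
- move=> w /nondegenerate[_ injX]; split => [[dL cl]|].
    by rewrite /E /= -cl; exact: decreasing_along_insert.
  by move=> /(decreasing_along_insert_inv Ln ln)[].
Qed.

Lemma prob_rank_lt L n k : perm_eq L (iota 0 n) -> (k <= n.+1)%N ->
  P (E L `&` [set w | (c n w < k)%N]) = (k%:R%:E * P (E (iota 0 n.+1)))%E.
Proof.
move=> Ln kn.
rewrite (@prob_partition N _ (iota 0 k) (fun l => [set w | c n w = l])) ?iota_uniq//.
- rewrite (eq_big_seq (fun=> P (E (iota 0 n.+1)))).
    rewrite big_const_seq count_predT size_iota mule_natl.
    exact: (@iter_addr_0 (\bar R)).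
  move=> l; rewrite mem_iota/= add0n => lk.
  rewrite -(prob_rank_eq Ln (l := l)); last by rewrite -ltnS (leq_trans lk).
  congr (P _); apply/seteqP; split => w /= [].
    by move=> [EL _] cl.
  by move=> EL cl; rewrite cl.
- apply: measurableI; first exact: mE Ln.
  exact: (mc n [set j | (j < k)%N]).
- by move=> l _; exact: (mc n [set j | j = l]).
- by move=> w i j _ _ _ /= -> ->.
- by move=> w _ [_ /= ck]; exists (c n w) => //; rewrite mem_iota.
Qed.

Lemma prob_order L n : perm_eq L (iota 0 n) ->
  P (E L) = (n.+1%:R%:E * P (E (iota 0 n.+1)))%E.
Proof.
move=> Ln; rewrite -(prob_rank_lt Ln (leqnn _)); congr (P _).
apply/seteqP; split => w /=; last by move=> [].
by split=> //; rewrite ltnS (leq_trans (count_size _ _)) ?size_mkseq.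
Qed.

Let mM_eq n k : measurable [set w | M n w = k].
Proof. exact: (mM n [set j | j = k]). Qed.

Let partition_orders n A : measurable A ->
  P A = (\sum_(L <- permutations (iota 0 n)) P (A `&` E L))%E.
Proof.
move=> mA; apply: (prob_partition nN) => //.
- exact: permutations_uniq.
- by move=> L; rewrite mem_permutations; exact: mE.
- move=> w L L' _; rewrite !mem_permutations => Ln L'n dL dL'.
  by apply: decreasing_along_uniq dL dL'; rewrite (permPl Ln) perm_sym.
- move=> w /nondegenerate[_ injX] _.
  have [L Ln dL] := decreasing_along_exists injX (iota_uniq 0 n).
  by exists L => //; rewrite mem_permutations.
Qed.

Lemma order_accepted_le L n : (order_accepted r L n <= n)%N.
Proof. by elim: n => //= n ih; rewrite (leq_trans (leq_add ih (leq_b1 _)))// addn1. Qed.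

Lemma prob_accept n k :
  fine (P [set w | M n w = k /\ (c n w < r k)%N]) =
  fine (P [set w | M n w = k]) * jump_prob R r n k.
Proof.
have mA : measurable [set w | M n w = k /\ (c n w < r k)%N].
  by apply: measurableI; [exact: mM_eq|exact: (mc n [set j | (j < r k)%N])].
suff : (P [set w | M n w = k /\ (c n w < r k)%N] =
        P [set w | M n w = k] * (jump_prob R r n k)%:E)%E.
  by move=> ->; rewrite fineM// fin_num_measure.
rewrite (partition_orders n mA) (partition_orders n (mM_eq n k)).
rewrite ge0_sume_distrl; last by move=> L _; exact: measure_ge0.
rewrite !big_seq; apply: eq_bigr => L; rewrite mem_permutations => Ln.
have ME w : ~ N w -> E L w -> M n w = order_accepted r L n.
  move=> /nondegenerate[Xpos _] dL.
  exact: (size_accepted_order r_gt0 r_step Xpos Ln dL).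
have mEL : measurable (E L) by exact: mE Ln.
have mL : measurable ([set w | M n w = k /\ (c n w < r k)%N] `&` E L).
  exact: measurableI.
have mL' : measurable ([set w | M n w = k] `&` E L) by exact: measurableI.
(* The order [L] decides whether [M n = k]: if not, both terms vanish; if so, only the rank
   condition remains. *)
have [ok|nk] := eqVneq (order_accepted r L n) k; last first.
  have -> : P ([set w | M n w = k /\ (c n w < r k)%N] `&` E L) = P set0.
    apply: (eq_prob_off_null nN) => // w nw; split => // -[[Mk _] dL].
    by move/eqP: nk; rewrite -(ME w).
  have -> : P ([set w | M n w = k] `&` E L) = P set0.
    apply: (eq_prob_off_null nN) => // w nw; split => // -[Mk dL].
    by move/eqP: nk; rewrite -(ME w).
  by rewrite measure0 mul0e.
have -> : P ([set w | M n w = k /\ (c n w < r k)%N] `&` E L) =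
    P (E L `&` [set w | (c n w < r k)%N]).
  apply: (eq_prob_off_null nN) => //.
    by apply: measurableI => //; exact: (mc n [set j | (j < r k)%N]).
  move=> w nw; split => [[[_ ck] dL]//|[dL ck]]; split => //; split => //.
  by rewrite ME.
have -> : P ([set w | M n w = k] `&` E L) = P (E L).
  apply: (eq_prob_off_null nN) => // w nw; split => [[]//|dL]; split => //=.
  by rewrite ME.
have kn : (k <= n)%N by rewrite -ok order_accepted_le.
rewrite (prob_order Ln) (prob_rank_lt Ln); last exact: leq_trans (r_le k) _.
rewrite [in RHS]muleC muleA; congr (_ * _)%E.
by rewrite -EFinM /jump_prob divfK// pnatr_eq0.
Qed.

Lemma prob_size_accepted n k : fine (P [set w | M n w = k]) = chain_law R r n k.
Proof.
elim: n k => [|n ih] k /=.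
  have [->|k0] := eqVneq k 0%N.
    by rewrite (_ : [set _ | _] = setT) ?probability_setT//; apply/seteqP.
  rewrite (_ : [set _ | _] = set0) ?measure0//; apply/seteqP; split => // w /= e.
  by move/eqP: k0; rewrite -e.
have mS j : measurable [set w | M n w = j /\ (c n w < r j)%N].
  by apply: measurableI; [exact: mM_eq|exact: (mc n [set i | (i < r j)%N])].
have mD j : measurable [set w | M n w = j /\ ~~ (c n w < r j)%N].
  by apply: measurableI; [exact: mM_eq|exact: (mc n [set i | ~~ (i < r j)%N])].
have stay : fine (P [set w | M n w = k /\ ~~ (c n w < r k)%N]) =
    chain_law R r n k * (1 - jump_prob R r n k).
  rewrite -ih mulrBr mulr1 -prob_accept; apply/eqP; rewrite -subr_eq opprK eq_sym.
  rewrite -fineD ?fin_num_measure// -measureU//.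
    apply/eqP; congr (fine (P _)); apply/seteqP; split => w /=.
      by move=> Mk; case: (boolP (c n w < r k)%N) => h; [right|left].
    by move=> [[]|[]].
  by apply/seteqP; split => // w /= [[_ /negP h] [_ h']].
have step w : ~ N w -> M n.+1 w = (M n w + (c n w < r (M n w)))%N.
  by move=> /nondegenerate[Xpos _]; exact: size_acceptedS.
case: k stay => [|k] stay.
  rewrite addr0 -stay; congr fine; apply: (eq_prob_off_null nN) => //.
  move=> w nw /=; rewrite step//; split.
    by move/eqP; rewrite addn_eq0 eqb0 => /andP[/eqP Mw]; rewrite Mw.
  by move=> [-> /negbTE ->].
rewrite -stay -ih -prob_accept -fineD ?fin_num_measure// -measureU//.
  congr fine; apply: (eq_prob_off_null nN) => //; first exact: measurableU.
  move=> w nw /=; rewrite step//; case: ltnP => h; rewrite ?addn1 ?addn0; split.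
  - by move=> [Mk]; right; rewrite -Mk.
  - by move=> [[Mk]|[-> //]]; rewrite -Mk h.
  - by move=> Mk; left; rewrite -Mk -leqNgt.
  - by move=> [[]//|[Mk]]; rewrite -Mk ltnNge h.
by apply/seteqP; split => // w /= [[-> _] [/eqP]]; rewrite eqn_leq ltnn.
Qed.

Lemma prob_size_accepted_ge n m :
  P [set w | (m <= M n w)%N] = (reach_prob R r n m)%:E.
Proof.
have mA : measurable [set w | (m <= M n w)%N] by exact: (mM n [set j | (m <= j)%N]).
rewrite (@prob_partition N _ (iota 0 n.+1) (fun k => [set w | M n w = k]))//.
- rewrite /reach_prob /chain_mean -sumEFin -(big_mkord xpredT
    (fun k => (chain_law R r n k * (m <= k)%N%:R)%:E)) /index_iota subn0.
  apply: eq_bigr => k _; rewrite -prob_size_accepted EFinM fineK ?fin_num_measure//.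
  have [mk|km] := leqP m k; rewrite ?mule1 ?mule0.
    congr (P _); apply/seteqP; split => w /=; first by move=> [].
    by move=> ->.
  rewrite (_ : _ `&` _ = set0) ?measure0//; apply/seteqP; split => // w /= [h e].
  by move: h; rewrite e leqNgt km.
- exact: iota_uniq.
- by move=> w i j _ _ _ /= -> ->.
- move=> w _ _; exists (M n w) => //; rewrite mem_iota/= add0n ltnS.
  rewrite /M acceptedE size_mask ?size_mkseq ?size_accepted_mask//.
  by rewrite (leq_trans (count_size _ _)) ?size_accepted_mask.
Qed.

End accepted_law.

(** * Exponential values and the hiring time *)

Lemma exponential_prob_null (R : realType) (A : set R) :
  measurable A -> lebesgue_measure A = 0%E -> exponential_prob 1 A = 0%E.
Proof.
move=> mA A0; apply: null_set_integral => //.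
apply/measurable_funTS/measurable_EFinP; exact: measurable_exponential_pdf.
Qed.

Lemma exponential_prob_le0 (R : realType) :
  exponential_prob 1 [set y : R | y <= 0] = 0%E.
Proof.
rewrite (_ : [set _ | _] = `]-oo, 0]%classic); last first.
  by apply/seteqP; split => y /=; rewrite in_itv.
have mf : measurable_fun setT (fun y : R => (exponential_pdf 1 y)%:E).
  by apply/measurable_EFinP; exact: measurable_exponential_pdf.
(* The density vanishes for [y < 0] but not at 0, so the endpoint is removed. *)
rewrite /exponential_prob -integral_itv_bndo_bndc; last exact: measurable_funTS.
apply: integral0_eq => y /=; rewrite in_itv/= => y0.
by rewrite lt0_exponential_pdf.
Qed.

Section hiring_time.
Context (R : realType) d (T : measurableType d) (P : probability T R).
Variables (X : nat -> {RV P >-> R}) (r : nat -> nat).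
Hypothesis r0 : r 0%N = 1%N.
Hypothesis r_step : forall m : nat, (r m <= r m.+1 <= (r m).+1)%N.
Hypothesis X_indep : mutually_independent X.
Hypothesis X_exp : forall n : nat, has_law (X n) (exponential_prob 1).

Let index m (w : T) := accepted_index r (X ^~ w) m.
Let r_gt0 := rank_gt0 r0 r_step.
Let r_le := rank_le r0 r_step.

Lemma prob_size_accepted_ge_exp n m :
  P [set w | (m <= size (accepted r (X ^~ w) n))%N] = (reach_prob R r n m)%:E.
Proof.
apply: (prob_size_accepted_ge X_indep X_exp) => //.
- move=> y; apply: exponential_prob_null => //; exact: lebesgue_measure_set1.
- exact: exponential_prob_le0.
Qed.

Lemma measurable_accepted_index m : discrete_measurable (index m).
Proof. exact: discrete_measurable_accepted_index. Qed.

(** The default value 0 means that [m] acceptances never occur; this has probability at most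
    [1 - reach_prob R r n m] for every [n]. *)
Lemma prob_index_eq0 m : (0 < m)%N -> P [set w | index m w = 0%N] = 0%E.
Proof.
move=> m0.
have mI := measurable_accepted_index m 0%N.
have h n : (fine (P [set w | index m w = 0%N]) <= 1 - reach_prob R r n m).
  rewrite -lee_fin fineK ?fin_num_measure// EFinB -prob_size_accepted_ge_exp.
  rewrite -probability_setC; last first.
    exact: (discrete_measurable_set [set k : nat | (m <= k)%N]
      (discrete_measurable_size_accepted r_gt0 (fun k => measurable_funPT (X k)) n)).
  apply: le_measure; rewrite ?inE//.
    apply: measurableC.
    exact: (discrete_measurable_set [set k : nat | (m <= k)%N]
      (discrete_measurable_size_accepted r_gt0 (fun k => measurable_funPT (X k)) n)).
  move=> w /= i0; apply/negP; rewrite -(accepted_index_le r (X ^~ w) n m0).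
  by rewrite -/(index m w) i0.
have c0 : (1 - reach_prob R r n m) @[n --> \oo] --> (1 - 1 : R).
  by apply: cvgB; [exact: cvg_cst|exact: reach_prob_cvg1].
have : fine (P [set w | index m w = 0%N]) <= 0.
  rewrite -(subrr 1) -(cvg_lim _ c0)//; apply: limr_ge; last exact: nearW.
  by apply/cvg_ex; eexists; exact: c0.
move=> le0; rewrite -[LHS]fineK ?fin_num_measure//; congr EFin.
by apply/eqP; rewrite eq_le le0 fine_ge0.
Qed.

(** The largest [n >= 1] with [ln n <= b + t * s], or 0 if there is none. *)
Definition quantile_index (t b s : R) : nat := Num.truncn (expR (b + t * s)).

Lemma le_quantile_index (t b s : R) n : 0 < s -> (0 < n)%N ->
  ((ln n%:R - b) / s <= t) = (n <= quantile_index t b s)%N.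
Proof.
move=> s0 n0; rewrite ler_pdivrMr// lerBlDl -ler_expR lnK ?posrE ?ltr0n//.
by rewrite truncn_ge_nat// expR_ge0.
Qed.

Lemma prob_index_le (t b s : R) m : (0 < m)%N -> 0 < s ->
  P [set w | (ln ((index m w)%:R : R) - b) / s <= t] =
  (reach_prob R r (quantile_index t b s) m)%:E.
Proof.
move=> m0 s0; rewrite -prob_size_accepted_ge_exp.
have mI := measurable_accepted_index m.
(* Where the index is 0, [ln] takes a default value and the two events may differ. *)
apply: (@eq_prob_off_null _ _ _ P [set w | index m w = 0%N]).
- by apply/negligibleP; [exact: mI|exact: prob_index_eq0].
- exact: (discrete_measurable_set [set k : nat | (ln (k%:R : R) - b) / s <= t] mI).
- exact: (discrete_measurable_set [set k : nat | (m <= k)%N]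
      (discrete_measurable_size_accepted r_gt0 (fun k => measurable_funPT (X k)) _)).
- move=> w /eqP; rewrite -lt0n /= => i0.
  by rewrite le_quantile_index// -(accepted_index_le r (X ^~ w) _ m0) -/(index m w) i0.
Qed.

End hiring_time.

(** Truncation gives [ln n <= b + t * s <= ln (n + 1)], and the harmonic sum lies between
    [ln (n + 1)] and [1 + ln n]. The distance from [S] to [b] adds 1 to each side. For [n = 0] there
    is no upper bound, as [ln n] makes no sense. *)
Lemma quantile_index_bounds (R : realType) (t b s S : R) :
  `|S - b| <= 1 ->
  let n := quantile_index t b s in
  (n = 0%N \/ series harmonic n - S <= t * s + 2) /\
  t * s - 1 <= series harmonic n - S.
Proof.
rewrite ler_norml => /andP[b1 b2] n; split.
  case E : n => [|k]; [by left|right].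
  have := harmonic_le_ln R k.
  have : ln k.+1%:R <= b + t * s.
    rewrite -ler_expR lnK ?posrE ?ltr0n//.
    by rewrite -truncn_ge_nat ?expR_ge0// -E.
  set l := ln _; set h := series _ _; lra.
have := harmonic_ge_ln R n.
have : b + t * s <= ln n.+1%:R.
  by rewrite -ler_expR lnK ?posrE ?ltr0n// ltW// truncnS_gt.
set l := ln _; set h := series _ _; lra.
Qed.

Theorem theorem7p5 (R : realType) (d : measure_display) (T : measurableType d)
    (P : probability T R) (X : nat -> {RV P >-> R}) (r : nat -> nat)
    (r0 : r 0%N = 1%N)
    (r_step : forall m : nat, (r m <= r m.+1 <= (r m).+1)%N)
    (X_indep : mutually_independent X)
    (X_exp : forall n : nat, has_law (X n) (exponential_prob 1))
    (r_div : (\sum_(0 <= m <oo) (((r m)%:R ^+ 2)^-1 : R)%:E = +oo)%E) :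
  cvg_in_distribution P
    (fun (m : nat) (w : T) =>
       let N := accepted_index r (fun k => X k w) m in
       (ln (N%:R : R) - (ysum R r m + ln (r m)%:R)) / sigmahat R r m)
    (normal_prob 0 1).
Proof.
split=> [m|t _].
  have mI := measurable_accepted_index X r0 r_step m.
  move=> _ A mA; rewrite setTI.
  exact: (discrete_measurable_set [set k : nat | A ((ln (k%:R : R) -
    (ysum R r m + ln (r m)%:R)) / sigmahat R r m)] mI).
have sig := sigmahat_dvg r0 r_step r_div.
pose N m := quantile_index t (ysum R r m + ln (r m)%:R) (sigmahat R r m).
have HN m := quantile_index_bounds t (sigmahat R r m) (inv_sum_center R r0 r_step m).
have cvgN : (reach_prob R r (N m) m)%:E @[m --> \oo] --> (normal_cdf t)%:E.
  apply: cvg_EFin; first exact: nearW.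
  apply: (reach_prob_cvg_normal (rank_gt0 r0 r_step) (rank_le r0 r_step) _ sig).
  - by move=> m; exact: sqrtr_ge0.
  - exact: sigmahat_bounds.
  - by move=> m; have [] := HN m.
  - by move=> m; have [] := HN m.
rewrite -normal_cdfE in cvgN.
apply: cvg_trans cvgN; apply: near_eq_cvg.
(* The formula for the probability needs [0 < m] and a positive [sigmahat], which hold from some [m]
   on. *)
have /cvgryPgt/(_ 0) := sig.
apply: filterS2 (nbhs_infty_gt 0%N) => m m0 s0.
by rewrite -(prob_index_le r0 r_step X_indep X_exp t _ m0 s0).
Qed.
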